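(* Let $k\in\mathbb{R}$, let $\tilde p:\mathbb{D}\to\mathbb{C}$ be holomorphic with $\operatorname{Re}\tilde p\ge0$ and Taylor expansion $\tilde p(z)=\sum_{n=0}^\infty a_nz^n$ in $\mathbb{D}$, and let $\Psi_t(z,\omega)$ be the diffusion in $\mathbb{D}$ defined in the context. Then for every function $f$ analytic in $\mathbb{D}$ and every $z\in\mathbb{D}$, the infinitesimal generator $Af(z)=\lim_{t\downarrow0}\frac{\mathsf{E}f(\Psi_t(z))-f(z)}{t}$ of $\Psi_t$ is given by $$A=\left(-\frac{k^2}{2}z+(z-1)^2\tilde p(z)\right)\frac{\partial}{\partial z}-\frac12k^2z^2\frac{\partial^2}{\partial z^2},$$ which can be written as $$A=-\sum_{n=-1}^\infty\left(a_{n+1}-2a_n+a_{n-1}\right)\mathcal{L}_n-\frac{k^2}{2}\mathcal{L}_0^2,\qquad a_{-1}=a_{-2}=0,$$ where $\mathcal{L}_n=-z^{n+1}\frac{\partial}{\partial z}$.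
   Context: $\mathbb{D}$ is the open unit disk. Let $B_t(\omega)$ be a standard 1-dimensional Brownian motion ($B_0=0$, continuous paths) on a standard filtered probability space $(\Omega,\mathcal{F},(\mathcal{F}_t),P)$, with expectation $\mathsf{E}$, and let $\tau(t,\omega)=e^{ikB_t(\omega)}$. For each fixed $\omega$ let $\phi_t(z,\omega)$ be the unique solution, for $z\in\mathbb{D}$ and $t\ge0$, of $$\frac{d}{dt}\phi_t(z,\omega)=\frac{(\tau(t,\omega)-\phi_t(z,\omega))^2}{\tau(t,\omega)}\,\tilde p\!\left(\frac{\phi_t(z,\omega)}{\tau(t,\omega)}\right),\qquad \phi_0(z,\omega)=z;$$ for each $\omega$ and $t$, $z\mapsto\phi_t(z,\omega)$ is a holomorphic self-map of $\mathbb{D}$. Put $\Psi_t(z,\omega)=\phi_t(z,\omega)/\tau(t,\omega)$. Equivalently, $\Psi_t$ solves the It\^o equation $d\Psi_t=-ik\Psi_t\,dB_t+\left(-\frac{k^2}{2}\Psi_t+(\Psi_t-1)^2\tilde p(\Psi_t)\right)dt$, $\Psi_0(z)=z$. *)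

(* Defs.v *)
From HB Require Import structures.
From mathcomp Require Import all_boot all_order all_algebra.
From mathcomp Require Import all_classical all_reals all_analysis.
From mathcomp Require Export complex.

Set Implicit Arguments.
Unset Strict Implicit.
Unset Printing Implicit Defensive.
Import Order.TTheory GRing.Theory Num.Theory.
Import numFieldNormedType.Exports.

Local Open Scope classical_set_scope.
Local Open Scope ring_scope.
Local Open Scope complex_scope.

(* R[i] as a normed space over itself: its topology is given by the modulus,
   and [derivable _ _ 1], [derive1] are complex differentiation. *)
#[warnings="-redundant-canonical-projection"]
HB.instance Definition _ (R : realType) :=
  NormedModule.copy R[i] R[i]^o.

Definition unit_disk {R : realType} : set R[i] := [set z | `|z| < 1].

(* Functions on the disk are total functions on R[i]; only their values on the
   disk matter. *)
Definition holomorphic_on (R : realType) (D : set R[i]) (f : R[i] -> R[i]) :=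
  forall z, D z -> derivable f z 1.

Definition analytic_on (R : realType) (D : set R[i]) (f : R[i] -> R[i]) :=
  forall z0, D z0 -> exists c : nat -> R[i],
    \forall z \near z0, series (fun n => c n * (z - z0) ^+ n) @ \oo --> f z.

Definition expi (R : realType) (x : R) : R[i] := cos x +i* sin x.

Definition filtration (R : realType) (d : measure_display)
    (Omega : measurableType d) (F : R -> set (set Omega)) :=
  [/\ forall t : R, 0 <= t -> sigma_algebra setT (F t),
      forall t : R, 0 <= t -> F t `<=` measurable &
      forall s t : R, 0 <= s -> s <= t -> F s `<=` F t].

(* [normal_prob m s] has standard deviation [s], i.e. variance [s ^+ 2]. *)
Record brownian_motion (R : realType) (d : measure_display)
    (Omega : measurableType d) (P : probability Omega R)
    (F : R -> set (set Omega)) (B : R -> Omega -> R) : Prop := {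
  bm_start : forall w, B 0 w = 0 ;
  bm_continuous : forall w, {within `[0, +oo[, continuous (fun t => B t w)} ;
  bm_adapted : forall t : R, 0 <= t ->
    forall U : set R, measurable U -> F t (B t @^-1` U) ;
  bm_independent : forall s t : R, 0 <= s -> s < t ->
    forall (A : set Omega) (U : set R), F s A -> measurable U ->
    P (A `&` (B t \- B s) @^-1` U) = (P A * P ((B t \- B s)%R @^-1` U))%E ;
  bm_normal : forall s t : R, 0 <= s -> s < t ->
    forall U : set R, measurable U ->
    P ((B t \- B s) @^-1` U) = normal_prob 0 (Num.sqrt (t - s)) U
}.

(* Derivative at t of a complex-valued function of real time on [0, +oo[
   (one-sided at t = 0). *)
Definition has_time_derivative (R : realType) (g : R -> R[i]) (t : R)
    (v : R[i]) :=
  (g (t + h) - g t) / h%:C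
    @[h --> within [set h | 0 <= t + h] (0 : R)^'] --> v.

(* [phi t z w] solves, for every [w] and every [z] in the disk, the Loewner
   equation driven by [tau]; as [p] lives on the disk, a solution stays in it. *)
Definition loewner_flow (R : realType) (Omega : Type) (p : R[i] -> R[i])
    (tau : R -> Omega -> R[i]) (phi : R -> R[i] -> Omega -> R[i]) :=
  forall w z, unit_disk z ->
    phi 0 z w = z /\
    forall t, 0 <= t -> unit_disk (phi t z w) /\
      has_time_derivative (fun s => phi s z w) t
        ((tau t w - phi t z w) ^+ 2 / tau t w * p (phi t z w / tau t w)).

Definition boundary_point (R : realType) (Omega : Type) (k : R)
    (B : R -> Omega -> R) (t : R) (w : Omega) : R[i] := expi (k * B t w).

Definition Psi (R : realType) (Omega : Type) (k : R) (B : R -> Omega -> R)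
    (phi : R -> R[i] -> Omega -> R[i]) (t : R) (z : R[i]) (w : Omega) : R[i] :=
  phi t z w / boundary_point k B t w.

Definition cintegrable (R : realType) (d : measure_display)
    (Omega : measurableType d) (P : probability Omega R) (X : Omega -> R[i]) :=
  P.-integrable setT (fun w => (complex.Re (X w))%:E) /\
  P.-integrable setT (fun w => (complex.Im (X w))%:E).

Definition cexpectation (R : realType) (d : measure_display)
    (Omega : measurableType d) (P : probability Omega R) (X : Omega -> R[i])
    : R[i] :=
  fine ('E_P[fun w => complex.Re (X w)])%E
    +i* fine ('E_P[fun w => complex.Im (X w)])%E.

(* The infinitesimal generator of [X] is defined at [f] and [z], with value
   [v]; the expectations are required to exist for small times. *)
Definition generator_at (R : realType) (d : measure_display)
    (Omega : measurableType d) (P : probability Omega R)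
    (X : R -> R[i] -> Omega -> R[i]) (f : R[i] -> R[i]) (z v : R[i]) :=
  (\forall t \near (0 : R)^'+, cintegrable P (fun w => f (X t z w))) /\
  (cexpectation P (fun w => f (X t z w)) - f z) / t%:C
    @[t --> (0 : R)^'+] --> v.

Definition A_op (R : realType) (k : R) (p f : R[i] -> R[i]) (z : R[i]) : R[i] :=
  (- (k ^+ 2 / 2)%:C * z + (z - 1) ^+ 2 * p z) * derive1 f z
  - (k ^+ 2 / 2)%:C * z ^+ 2 * derive1n 2 f z.

(* Used only for n >= -1. *)
Definition L_op (R : realType) (n : int) (f : R[i] -> R[i]) (z : R[i]) : R[i] :=
  - z ^ (n + 1) * derive1 f z.

(* Extension of the Taylor coefficients by 0 to negative indices. *)
Definition coefz (R : realType) (a : nat -> R[i]) (n : int) : R[i] :=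
  if n is Posz m then a m else 0.

Definition second_diff (R : realType) (a : nat -> R[i]) (n : int) : R[i] :=
  coefz a (n + 1) - 2 * coefz a n + coefz a (n - 1).

(* The partial sums of the series over n >= -1, reindexed by n = m - 1. *)
Definition L_series (R : realType) (a : nat -> R[i]) (f : R[i] -> R[i])
    (z : R[i]) : nat -> R[i] :=
  series (fun m : nat => second_diff a (m%:Z - 1) * L_op (m%:Z - 1) f z).

(* Main.v *)
Require Import Defs.
From HB Require Import structures.
From mathcomp Require Import all_boot all_order all_algebra.
From mathcomp Require Import all_classical all_reals all_analysis.
From mathcomp Require Import measurable_realfun ring lra zify.
Set Implicit Arguments.
Unset Strict Implicit.
Unset Printing Implicit Defensive.
Import Order.TTheory GRing.Theory Num.Theory.
Import numFieldNormedType.Exports.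
Import ComplexField.Normc.

Local Open Scope classical_set_scope.
Local Open Scope ring_scope.
Local Open Scope complex_scope.

(* With x = B_t and xi_t = phi_t - z one has Psi_t = (z + xi_t) exp(- i k x),
   so f(Psi_t) can be expanded without stochastic calculus.  On a short time
   interval |xi_t| <= M t uniformly in omega, and a second order Taylor expansion
   of f at z, with the powers x and x^2 / 2 replaced by sinh x and cosh x - 1,
   gives
     f(Psi_t) = f(z) + f'(z) xi_t + al sinh x + be (cosh x - 1) + error.
   The hyperbolic functions are chosen because E exp(l B_t) = exp(l^2 t / 2)
   follows from the Gaussian density alone by completing the square: sinh B_t has
   mean 0, cosh B_t - 1 has mean exp(t / 2) - 1, and the error has mean
   O(t^(3/2)).  By dominated convergence E xi_t / t tends to the initial speed
   (z - 1)^2 p(z) of the Loewner equation.  That phi_t is measurable in omega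
   follows from its being the limit of explicit Euler schemes. *)

(** Two obstacles shape the argument. First, [f] is controlled only inside the open disk while B_t
    is unbounded. Rotation preserves the modulus, so |Psi_t| = |phi_t|, and for short times phi_t
    stays in a fixed disk of radius r < 1 whatever the path. Hence [f] is bounded along Psi_t, and
    its cubic Taylor bound can be used for every value of x, however large. Second, xi_t depends on
    the whole path up to time t and is correlated with B_t. But it is O(t), so the products of xi_t
    with the rotation are O(t |x|), of mean O(t^(3/2)), and xi_t matters only through its own mean.
    The coefficients come from exp(- i k x) = 1 - i k sinh x - k^2 (cosh x - 1) + O(|x|^3) near 0.
    This gives al = - i k z f'(z) and be = - k^2 (z f'(z) + z^2 f''(z)). The mean of cosh B_t - 1
    turns be into be / 2, the part of A carrying k^2, and the Loewner speed supplies the other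
    part. *)

Section complex_modulus.
Variable R : realType.
Implicit Types (x y z : R[i]) (r : R).

Lemma normC_normc z : `|z| = (normc z)%:C.
Proof. by []. Qed.

Lemma normc_ge0 z : 0 <= normc z.
Proof. by case: z => a b; exact: sqrtr_ge0. Qed.

Lemma normcB x y : normc (x - y) = normc (y - x).
Proof. by rewrite -normcN opprB. Qed.

Lemma le_normcB x y : normc (x - y) <= normc x + normc y.
Proof. by rewrite (le_trans (le_normcD _ _))// normcN. Qed.

Lemma normcX z n : normc (z ^+ n) = normc z ^+ n.
Proof.
by elim: n => [|n IH]; rewrite ?expr0 ?normc1// !exprS normcM IH.
Qed.

Lemma normcC r : normc r%:C = `|r|.
Proof. by rewrite /= expr0n addr0 sqrtr_sqr. Qed.

Lemma unit_diskE z : unit_disk z = (normc z < 1) :> Prop.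
Proof. by rewrite /unit_disk /= normC_normc -(ltcR (normc z) 1). Qed.

Lemma normRe_le z : `|complex.Re z| <= normc z.
Proof. by have := normc_ge_Re z; rewrite normC_normc lecR. Qed.

Lemma normIm_le z : `|complex.Im z| <= normc z.
Proof.
case: z => a b /=; rewrite -(sqrtr_sqr b) ler_sqrt ?addr_ge0 ?sqr_ge0//.
by rewrite lerDr sqr_ge0.
Qed.

Lemma normc_le z : normc z <= `|complex.Re z| + `|complex.Im z|.
Proof.
case: z => a b /=; rewrite -[leRHS]ger0_norm ?addr_ge0// -sqrtr_sqr.
rewrite ler_sqrt ?sqr_ge0// sqrrD !real_normK ?num_real//.
by rewrite lerD2r lerDl mulrn_wge0 ?mulr_ge0.
Qed.

Lemma cvgCP (T : Type) (F : set_system T) {FF : Filter F} (g : T -> R[i]) (l : R[i]) :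
  g @ F --> l <->
  forall e, 0 < e -> \forall t \near F, normc (l - g t) < e.
Proof.
split=> [/cvgrPdist_lt cg e e0|cg].
  have e0' : 0 < e%:C :> R[i] by rewrite ltcR.
  by have := cg _ e0'; apply: filterS => x; rewrite normC_normc ltcR.
apply/cvgrPdist_lt => e e0.
have [r ee] : exists r, e = r%:C by apply/complex_realP/gtr0_real.
move: e0; rewrite ee ltcR => /cg; apply: filterS => x.
by rewrite normC_normc ltcR.
Qed.

Lemma cvgC_normc (T : Type) (F : set_system T) {FF : Filter F} (g : T -> R[i])
    (l : R[i]) :
  (forall e, 0 < e -> \forall t \near F, normc (l - g t) < e) -> g @ F --> l.
Proof. by rewrite cvgCP. Qed.

Lemma cvgC_parts (T : Type) (F : set_system T) {FF : Filter F}
    (g : T -> R[i]) (l : R[i]) :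
  (g @ F --> l) <-> ((fun t => complex.Re (g t)) @ F --> complex.Re l) /\
                    ((fun t => complex.Im (g t)) @ F --> complex.Im l).
Proof.
rewrite cvgCP; split=> [cg|[/cvgrPdist_lt cr /cvgrPdist_lt ci] e e0].
  split; apply/cvgrPdist_lt => e /cg; apply: filterS => x; apply: le_lt_trans.
    by rewrite /= -raddfB; exact: normRe_le.
  by rewrite /= -raddfB; exact: normIm_le.
have e2 : 0 < e / 2 by rewrite divr_gt0.
move: (cr _ e2) (ci _ e2); apply: filterS2 => x h1 h2.
rewrite (le_lt_trans (normc_le _))// [ltRHS]splitr ltrD//.
  by rewrite raddfB.
by rewrite raddfB.
Qed.

Lemma normc_lim_le (u : nat -> R[i]) l r :
  u @ \oo --> l -> (\forall n \near \oo, normc (u n) <= r) -> normc l <= r.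
Proof.
move=> /cvgCP ul ur; apply/ler_addgt0Pr => e /ul ule.
have [n [h1 h2]] := filter_ex (filterI ur ule).
rewrite -[l](subrK (u n)) (le_trans (le_normcD _ _))// addrC lerD//; exact: ltW.
Qed.

Lemma continuousCP (f : R[i] -> R[i]) z : {for z, continuous f} <->
  forall e : R, 0 < e -> exists2 d : R, 0 < d &
    forall w, normc (w - z) < d -> normc (f w - f z) < e.
Proof.
split=> [/cvgCP cf e /cf|cf].
  case/nbhs_ballP => d /= d0 H.
  have [r dr] : exists r, d = r%:C by apply/complex_realP/gtr0_real.
  exists r; first by move: d0; rewrite dr ltcR.
  move=> w wz; rewrite normcB; apply: H; rewrite -ball_normE /=.
  by rewrite normC_normc normcB dr ltcR.
apply: (@cvgC_normc _ (nbhs z)) => e /cf[d d0 H]; apply/nbhs_ballP; exists d%:C.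
  by rewrite /= ltcR.
move=> w; rewrite -ball_normE /= normC_normc ltcR => wz.
by rewrite normcB; apply: H; rewrite normcB.
Qed.

Lemma near_nbhsC (z : R[i]) (Q : R[i] -> Prop) :
  (\forall w \near z, Q w) <->
  exists2 d : R, 0 < d & forall w, normc (w - z) < d -> Q w.
Proof.
split.
  case/nbhs_ballP => d /= d0 H.
  have [r dr] : exists r, d = r%:C by apply/complex_realP/gtr0_real.
  exists r; first by move: d0; rewrite dr ltcR.
  move=> w wz; apply: H; rewrite -ball_normE /=.
  by rewrite normC_normc normcB dr ltcR.
move=> [d d0 H]; apply/nbhs_ballP; exists d%:C.
  by rewrite /= ltcR.
move=> w; rewrite -ball_normE /= normC_normc ltcR => wz.
by apply: H; rewrite normcB.
Qed.

(** Complex differentiability without a quotient and with real epsilon and delta: the increment 0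
    needs no separate treatment, and moduli can be compared by real arithmetic. *)
Definition cderiv (f : R[i] -> R[i]) z (l : R[i]) := forall e : R, 0 < e ->
  exists2 d : R, 0 < d & forall h, normc h < d ->
    normc (f (z + h) - f z - l * h) <= e * normc h.

Lemma cderivP (f : R[i] -> R[i]) z l : cderiv f z l <->
  (fun h => h^-1 *: (f (h *: 1 + z) - f z)) @ 0^' --> l.
Proof.
split=> [df|].
  apply: (@cvgC_normc _ (0 : R[i])^') => e e0; have e2 : 0 < e / 2 by rewrite divr_gt0.
  have [d d0 H] := df _ e2.
  apply/near_nbhsC; exists d => // h; rewrite subr0 => hd /eqP h0.
  have nh : 0 < normc h.
    by rewrite lt_def normc_ge0 andbT; apply/eqP => /eq0_normc.
  have -> : l - h^-1 *: (f (h *: 1 + z) - f z) =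
      - (h^-1 * (f (z + h) - f z - l * h)).
    rewrite [h *: 1]mulr1 (addrC h) /GRing.scale /=.
    by field; apply/eqP.
  rewrite normcN normcM normcV mulrC ltr_pdivrMr//.
  rewrite (le_lt_trans (H _ hd))// ltr_pM2r// ltr_pdivrMr//.
  by rewrite ltr_pMr// ltr1n.
move=> /cvgCP H e /H /near_nbhsC[d d0 {}H]; exists d => // h hd.
have [->|h0] := eqVneq h 0.
  by rewrite addr0 mulr0 subr0 subrr normc0 mulr0.
have := H h; rewrite subr0 => /(_ hd h0) {}H.
have -> : f (z + h) - f z - l * h =
    - (l - h^-1 *: (f (h *: 1 + z) - f z)) * h.
  by rewrite [h *: 1]mulr1 (addrC h) /GRing.scale /=; field.
by rewrite normcM normcN ler_wpM2r ?normc_ge0// ltW.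
Qed.

Lemma derivableCP (f : R[i] -> R[i]) z :
  derivable f z 1 <-> cderiv f z (derive1 f z).
Proof.
rewrite derive1E cderivP; split=> [//|H].
by apply/cvg_ex; eexists; exact: H.
Qed.

Lemma cderiv_derive1 {f : R[i] -> R[i]} {z l} : cderiv f z l -> derive1 f z = l.
Proof. by rewrite derive1E => /cderivP H; apply: cvg_lim. Qed.

Lemma cderiv_continuous (f : R[i] -> R[i]) z l :
  cderiv f z l -> {for z, continuous f}.
Proof.
move=> df; apply/continuousCP => e e0.
have [d d0 H] := df 1 ltr01.
have L0 : 0 < 1 + normc l by rewrite ltr_wpDr ?normc_ge0.
exists (Num.min d (e / (1 + normc l))).
  by rewrite lt_min d0 divr_gt0.
move=> w; rewrite lt_min ltr_pdivlMr// => /andP[wd we].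
have := H (w - z) wd; rewrite (addrC z) subrK mul1r => {}H.
rewrite -[f w - f z](subrK (l * (w - z))).
rewrite (le_lt_trans (le_normcD _ _))// normcM.
by rewrite (le_lt_trans _ we)// [leRHS]mulrDr mulr1 lerD// mulrC.
Qed.

End complex_modulus.

(** * Power series: Lipschitz estimates of tails *)

Section power_series.
Variable R : realType.

Lemma normc_sum (I : Type) (s : seq I) (Q : pred I) (F : I -> R[i]) :
  normc (\sum_(i <- s | Q i) F i) <= \sum_(i <- s | Q i) normc (F i).
Proof.
elim/big_ind2: _ => [|x a y b xa yb|//]; first by rewrite normc0.
by rewrite (le_trans (le_normcD _ _))// lerD.
Qed.

Lemma normc_subX (u v : R[i]) (r : R) n : normc u <= r -> normc v <= r ->
  normc (u ^+ n - v ^+ n) <= n%:R * r ^+ n.-1 * normc (u - v).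
Proof.
move=> ur vr; have r0 := le_trans (normc_ge0 _) ur.
rewrite subrXX normcM mulrC ler_wpM2r ?normc_ge0//.
rewrite (le_trans (normc_sum _ _ _))//.
rewrite (@le_trans _ _ (\sum_(i < n) r ^+ n.-1))//; last first.
  by rewrite sumr_const card_ord mulr_natl.
apply: ler_sum => i _; rewrite normcM !normcX.
have -> : n.-1 = (n.-1 - i + i)%N by have := ltn_ord i; lia.
by rewrite exprD addnK ler_pM ?exprn_ge0 ?normc_ge0// lerXn2r// nnegrE normc_ge0.
Qed.

(** Absorbs the factor n produced by differentiating a power into a slightly larger radius: s^n -
    d^n is s - d times a sum of n terms, each at least d^(n-1). *)
Lemma mulrn_expr_le (d s : R) n : 0 <= d -> d <= s ->
  n%:R * d ^+ n.-1 * (s - d) <= s ^+ n.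
Proof.
move=> d0 ds; rewrite (@le_trans _ _ (s ^+ n - d ^+ n))//; last first.
  by rewrite gerBl exprn_ge0.
rewrite subrXX mulrC ler_wpM2l ?subr_ge0//.
rewrite mulr_natl -[X in _ *+ X]card_ord -sumr_const.
apply: ler_sum => i _.
have -> : n.-1 = (n.-1 - i + i)%N by have := ltn_ord i; lia.
rewrite exprD addnK ler_wpM2r ?exprn_ge0// lerXn2r// nnegrE//.
exact: le_trans ds.
Qed.

Lemma geometric_sum_le (q : R) m N : 0 <= q -> q < 1 ->
  \sum_(m <= n < N) q ^+ n <= (1 - q)^-1.
Proof.
move=> q0 q1; have q1' : 0 < 1 - q by rewrite subr_gt0.
apply: (@le_trans _ _ (\sum_(0 <= n < N) q ^+ n)).
  have [Nm|mN] := leqP N m.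
    by rewrite big_geq// sumr_ge0// => i _; rewrite exprn_ge0.
  rewrite (@big_cat_nat _ _ _ m 0 N)//= ?(ltnW mN)// lerDr.
  by rewrite sumr_ge0// => i _; rewrite exprn_ge0.
rewrite -[leRHS]mul1r ler_pdivlMr// mulrC big_mkord.
have := subrX1 q N; rewrite -opprB -[X in _ = X * _]opprB mulNr => /oppr_inj <-.
by rewrite gerBl exprn_ge0.
Qed.

(** The gain is the factor r^m: the Lipschitz constant of the tail beyond degree m shrinks with the
    radius. It serves with m = 2 for the Taylor estimate of [f] and with m = 0 for the Lipschitz
    bound on [p]. A radius s strictly between d and rho absorbs the factor n of [normc_subX] and
    leaves a geometric series of ratio s / rho. *)
Lemma power_series_lipschitz (c : nat -> R[i]) (rho d K : R) (m : nat) :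
  0 < d -> d < rho -> (forall n, normc (c n) * rho ^+ n <= K) ->
  exists2 C, 0 <= C & forall N r u v, r <= d -> normc u <= r -> normc v <= r ->
  normc (\sum_(m.+1 <= n < N) c n * (u ^+ n - v ^+ n)) <=
    C * r ^+ m * normc (u - v).
Proof.
move=> d0 drho cK; 
have [s ds srho] : exists2 s, d < s & s < rho by exists ((d + rho) / 2); lra.
have s0 : 0 < s by exact: lt_trans ds.
have rho0 : 0 < rho by exact: lt_trans srho.
have K0 : 0 <= K.
  by apply: le_trans (cK 0%N); rewrite mulr_ge0 ?normc_ge0// exprn_ge0// ltW.
have q1 : s / rho < 1 by rewrite ltr_pdivrMr// mul1r.
have q0 : 0 <= s / rho by rewrite divr_ge0// ltW.
pose A := K / ((s - d) * d ^+ m).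
have A0 : 0 <= A.
  by rewrite divr_ge0// mulr_ge0 ?subr_ge0 ?exprn_ge0// ltW.
exists (A * (1 - s / rho)^-1).
  by rewrite mulr_ge0// invr_ge0 subr_ge0 ltW.
move=> N r u v rd ur vr.
have r0 := le_trans (normc_ge0 _) ur.
rewrite (le_trans (normc_sum _ _ _))//.
rewrite (@le_trans _ _ (\sum_(m.+1 <= n < N)
    A * r ^+ m * normc (u - v) * (s / rho) ^+ n))//; last first.
  rewrite -mulr_sumr.
  have -> : A * (1 - s / rho)^-1 * r ^+ m * normc (u - v) =
    A * r ^+ m * normc (u - v) * (1 - s / rho)^-1 by ring.
  apply: ler_wpM2l; last by apply: geometric_sum_le.
  by rewrite mulr_ge0 ?normc_ge0// mulr_ge0 ?exprn_ge0.
rewrite big_nat_cond [leRHS]big_nat_cond; apply: ler_sum => n /andP[/andP[mn _] _].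
rewrite normcM (le_trans (ler_wpM2l (normc_ge0 _) (normc_subX n ur vr)))//.
rewrite mulrA.
rewrite [leRHS](_ : _ = A * r ^+ m * (s / rho) ^+ n * normc (u - v)); last by ring.
rewrite ler_wpM2r ?normc_ge0//.
(* As n > m, m of the n - 1 factors r are kept and the others are enlarged to d. *)
have rn : r ^+ n.-1 * d ^+ m <= r ^+ m * d ^+ n.-1.
  have -> : n.-1 = (m + (n.-1 - m))%N by clear -mn; lia.
  rewrite !exprD -mulrA ler_wpM2l ?exprn_ge0// mulrC ler_wpM2l ?exprn_ge0//.
    exact: ltW.
  by rewrite lerXn2r// nnegrE ltW.
have dm : 0 < d ^+ m by rewrite exprn_gt0.
have sd : 0 < s - d by rewrite subr_gt0.
have rhon : 0 < rho ^+ n by rewrite exprn_gt0.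
have cn : normc (c n) <= K / rho ^+ n by rewrite ler_pdivlMr.
have nd := mulrn_expr_le n (ltW d0) (ltW ds).
apply: (@le_trans _ _ (K / rho ^+ n * (n%:R * (r ^+ m * d ^+ n.-1 / d ^+ m)))).
  rewrite ler_pM ?normc_ge0 ?mulr_ge0 ?exprn_ge0//.
  by rewrite ler_wpM2l// ler_pdivlMr.
have nd' : n%:R * d ^+ n.-1 <= s ^+ n / (s - d) by rewrite ler_pdivlMr.
have -> : K / rho ^+ n * (n%:R * (r ^+ m * d ^+ n.-1 / d ^+ m)) =
    (K / rho ^+ n * r ^+ m / d ^+ m) * (n%:R * d ^+ n.-1).
  by ring.
apply: (@le_trans _ _ ((K / rho ^+ n * r ^+ m / d ^+ m) * (s ^+ n / (s - d)))).
  apply: ler_wpM2l => //.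
  by rewrite !mulr_ge0 ?invr_ge0 ?exprn_ge0// ltW.
rewrite le_eqVlt; apply/orP; left; apply/eqP.
rewrite /A exprMn exprVn.
move: (rho ^+ n) (d ^+ m) (s ^+ n) (r ^+ m) rhon dm => a b e g a0 b0.
by field; rewrite !lt0r_neq0.
Qed.

Lemma cvg_power_series_bounded (c : nat -> R[i]) (w : R[i]) :
  cvgn (series (fun n => c n * w ^+ n)) ->
  exists K : R, forall n, normc (c n) * normc w ^+ n <= K.
Proof.
move=> /cvg_series_cvg_0 /cvgCP /(_ _ ltr01)[N _ H].
exists (1 + \sum_(n < N) normc (c n * w ^+ n)) => n.
rewrite -normcX -normcM.
have [Nn|nN] := leqP N n.
  have := H n Nn; rewrite sub0r normcN => /ltW /le_trans; apply.
  by rewrite lerDl sumr_ge0// => i _; exact: normc_ge0.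
rewrite (bigD1 (Ordinal nN))//= addrCA lerDl addr_ge0// sumr_ge0// => i _.
exact: normc_ge0.
Qed.

(** Two nearby points are compared, instead of one point with the centre: the estimate then also
    controls the derivative of [f] at points close to z, so that the second derivative is reached
    without differentiating the series termwise. *)
Lemma analytic_taylor2 (f : R[i] -> R[i]) (z : R[i]) (c : nat -> R[i]) :
  (\forall w \near z, series (fun n => c n * (w - z) ^+ n) @ \oo --> f w) ->
  exists C d : R, [/\ 0 < d, 0 <= C & forall r u v,
    r <= d -> normc u <= r -> normc v <= r ->
    normc (f (z + u) - f (z + v) - c 1%N * (u - v) - c 2%N * (u ^+ 2 - v ^+ 2))
      <= C * r ^+ 2 * normc (u - v)].
Proof.
move=> /near_nbhsC[e e0 H].
have e2 : 0 < e / 2 by rewrite divr_gt0.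
have e2e : e / 2 < e by lra.
have [|K cK] := @cvg_power_series_bounded c (e / 2)%:C.
  have := H (z + (e / 2)%:C); rewrite addrAC subrr add0r normcC gtr0_norm//.
  by move=> /(_ e2e) h; apply/cvg_ex; eexists; exact: h.
(* Coefficients are bounded at radius e / 2, and the estimate is claimed only up to e / 4, which
   leaves the gap that [power_series_lipschitz] needs. *)
have {}cK n : normc (c n) * (e / 2) ^+ n <= K.
  by have := cK n; rewrite normcC gtr0_norm.
have d0 : 0 < e / 4 by rewrite divr_gt0.
have dr : e / 4 < e / 2 by lra.
have [C C0 HC] := power_series_lipschitz 2 d0 dr cK.
exists C, (e / 4); split=> // r u v rd ur vr.
have cvgu x : normc x <= r ->
    series (fun n => c n * x ^+ n) @ \oo --> f (z + x).
  move=> xr; have := H (z + x); rewrite addrAC subrr add0r; apply.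
  by rewrite (le_lt_trans xr)// (le_lt_trans rd)//; lra.
pose S x := series (fun n => c n * x ^+ n).
have cv : (S u - S v - cst (c 1%N * (u - v)) - cst (c 2%N * (u ^+ 2 - v ^+ 2))) @ \oo -->
    f (z + u) - f (z + v) - c 1%N * (u - v) - c 2%N * (u ^+ 2 - v ^+ 2).
  by apply: cvgB; [apply: cvgB; [apply: cvgB; exact: cvgu|exact: cvg_cst]|exact: cvg_cst].
apply: normc_lim_le cv _.
exists 3%N => // N /= N3.
have := HC N _ _ _ rd ur vr; congr (_ <= _); congr normc.
rewrite !fctE /S /series /=.
under eq_bigr do rewrite mulrBr.
have -> : (\sum_(0 <= k < N) c k * u ^+ k - \sum_(0 <= k < N) c k * v ^+ k) =
    \sum_(0 <= k < 3) (c k * u ^+ k - c k * v ^+ k) +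
    \sum_(3 <= k < N) (c k * u ^+ k - c k * v ^+ k).
  by rewrite -sumrB -big_cat_nat.
by rewrite unlock /=; ring.
Qed.

End power_series.

(** * Analytic functions: first two derivatives, bounds on smaller disks *)

Section analytic_functions.
Variable R : realType.

(** Everything follows from the bound [key] on f'(z + v) - c_1 - 2 c_2 v. At v = 0, letting r tend
    to 0 identifies f'(z) with c_1. At v = h with r = 2 |h| the error is O(|h|^2), so f' has
    derivative 2 c_2 at z. *)
Lemma analytic_cderiv2 (f : R[i] -> R[i]) (z : R[i]) :
  analytic_on unit_disk f -> unit_disk z ->
  [/\ cderiv f z (derive1 f z),
      cderiv (derive1 f) z (derive1n 2 f z) &
      exists C d : R, [/\ 0 < d, 0 <= C & forall h, normc h <= d ->
        normc (f (z + h) - f z - derive1 f z * h - derive1n 2 f z / 2 * h ^+ 2)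
          <= C * normc h ^+ 3]].
Proof.
move=> fan.
have fder w : unit_disk w -> exists l, cderiv f w l.
  move=> /fan[c /analytic_taylor2[C [d [d0 C0 H]]]].
  exists (c 1%N) => e e0.
  pose k := normc (c 2%N) + C * d.
  have k0 : 0 <= k by rewrite addr_ge0 ?normc_ge0 ?mulr_ge0// ltW.
  exists (Num.min d (e / (k + 1))).
    by rewrite lt_min d0 divr_gt0// ltr_wpDl.
  move=> h; rewrite lt_min ltr_pdivlMr ?ltr_wpDl// => /andP[hd he].
  have := H (normc h) h 0 (ltW hd) (lexx _).
  rewrite normc0 => /(_ (normc_ge0 _)).
  rewrite addr0 expr0n subr0 subr0 => {}H.
  rewrite -[X in normc X](subrK (c 2%N * h ^+ 2)).
  rewrite (le_trans (le_normcD _ _))// normcM normcX.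
  have n0 := normc_ge0 h.
  apply: (@le_trans _ _ (normc h * k * normc h)).
    apply: (le_trans (lerD H (lexx _))); rewrite /k.
    have : C * normc h ^+ 2 * normc h <= C * d * normc h * normc h.
      rewrite expr2 !mulrA ler_wpM2r// ler_wpM2r// ler_wpM2l//; exact: ltW.
    lra.
  rewrite ler_wpM2r// (le_trans _ (ltW he))// ler_wpM2l//; lra.
move=> z1.
have [c /[dup] cz /analytic_taylor2[C [d [d0 C0 H]]]] := fan _ z1.
have z1' : normc z < 1 by rewrite -unit_diskE.
pose d' := Num.min d (1 - normc z).
have d'0 : 0 < d' by rewrite lt_min d0 subr_gt0.
have key (v : R[i]) r : normc v < r -> r < d' ->
    normc (derive1 f (z + v) - c 1%N - 2 * c 2%N * v) <= C * r ^+ 2.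
  move=> vr rd'; have r0 : 0 < r := le_lt_trans (normc_ge0 _) vr.
  have /fder[l ld] : unit_disk (z + v).
    rewrite unit_diskE (le_lt_trans (le_normcD _ _))//.
    have : r < 1 - normc z by move: rd'; rewrite lt_min => /andP[].
    lra.
  rewrite (cderiv_derive1 ld).
  apply/ler_addgt0Pr => e e0; have e2 : 0 < e / 2 by rewrite divr_gt0.
  have [g g0 Hg] := ld _ e2.
  pose k := 1 + normc (c 2%N).
  have k0 : 0 < k by rewrite ltr_pwDl ?normc_ge0.
  (* A real test increment: the first bound serves differentiability at z + v, the second keeps v +
     t within radius r, and the third makes c_2 t^2 at most (e / 2) t. *)
  pose t := Num.min (Num.min (g / 2) (r - normc v)) (e / 2 / k).
  have t0 : 0 < t by rewrite !lt_min subr_gt0 vr !divr_gt0.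
  have tg : t <= g / 2 by rewrite /t !ge_min lexx.
  have tr : t <= r - normc v by rewrite /t !ge_min lexx orbT.
  have te : t * k <= e / 2 by rewrite -ler_pdivlMr// /t !ge_min lexx !orbT.
  clearbody t.
  have nt : normc t%:C = t by rewrite normcC gtr0_norm.
  have h1 : normc (f (z + v + t%:C) - f (z + v) - l * t%:C) <= e / 2 * t.
    by rewrite -[X in _ <= _ * X]nt; apply: Hg; rewrite nt; lra.
  have h2 : normc (f (z + (v + t%:C)) - f (z + v) - c 1%N * (v + t%:C - v) -
      c 2%N * ((v + t%:C) ^+ 2 - v ^+ 2)) <= C * r ^+ 2 * t.
    rewrite -[X in _ <= _ * X]nt.
    rewrite [X in _ <= _ * normc X](_ : _ = v + t%:C - v); last by ring.
    apply: H; [|rewrite (le_trans (le_normcD _ _))// nt; lra|exact: ltW].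
    by apply/ltW; move: rd'; rewrite lt_min => /andP[].
  have h3 : normc (c 2%N * t%:C ^+ 2) <= e / 2 * t.
    rewrite normcM normcX nt expr2 mulrA ler_wpM2r ?(ltW t0)//.
    by rewrite (le_trans _ te)// mulrC ler_wpM2l ?(ltW t0)// lerDr.
  have : normc ((l - c 1%N - 2 * c 2%N * v) * t%:C) <= (C * r ^+ 2 + e) * t.
    have -> : (l - c 1%N - 2 * c 2%N * v) * t%:C =
       - (f (z + v + t%:C) - f (z + v) - l * t%:C) +
       (f (z + (v + t%:C)) - f (z + v) - c 1%N * (v + t%:C - v) -
      c 2%N * ((v + t%:C) ^+ 2 - v ^+ 2)) + c 2%N * t%:C ^+ 2.
      by rewrite (addrA z v); ring.
    rewrite (le_trans (le_normcD _ _))//.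
    have h4 := le_normcD (- (f (z + v + t%:C) - f (z + v) - l * t%:C))
       (f (z + (v + t%:C)) - f (z + v) - c 1%N * (v + t%:C - v) -
      c 2%N * ((v + t%:C) ^+ 2 - v ^+ 2)).
    rewrite normcN in h4; lra.
  by rewrite normcM nt ler_pM2r.
have E1 : derive1 f z = c 1%N.
  have [l ld] := fder z z1.
  apply/eqP; rewrite -subr_eq0; apply/eqP/eq0_normc/eqP.
  rewrite eq_le normc_ge0 andbT; apply/ler_addgt0Pr => e e0; rewrite add0r.
  pose r := Num.min (d' / 2) (e / (C * d' + 1)).
  have k0 : 0 < C * d' + 1 by rewrite ltr_wpDl ?mulr_ge0// ltW.
  have r0 : 0 < r by rewrite lt_min !divr_gt0.
  have rd : r <= d' / 2 by rewrite ge_min lexx.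
  have re : r * (C * d' + 1) <= e by rewrite -ler_pdivlMr// ge_min lexx orbT.
  have := key 0 r; rewrite normc0 addr0 mulr0 subr0 => /(_ r0).
  have rd' : r < d' by lra.
  move=> /(_ rd') /le_trans; apply; apply: le_trans re.
  rewrite expr2 mulrA mulrC ler_wpM2l ?(ltW r0)//.
  have := ler_wpM2l C0 (ltW rd'); lra.
have E2 : cderiv (derive1 f) z (2 * c 2%N).
  move=> e e0; have k0 : 0 < 4 * C + 1 by lra.
  exists (Num.min (d' / 2) (e / (4 * C + 1))); first by rewrite lt_min !divr_gt0.
  move=> h; rewrite lt_min => /andP[hd]; rewrite ltr_pdivlMr// => he.
  rewrite E1.
  have [->|h0] := eqVneq h 0.
    by rewrite addr0 mulr0 E1 !subrr normc0 mulr0.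
  have nh : 0 < normc h.
    by rewrite lt_def normc_ge0 andbT; apply: contraNneq h0 => /eq0_normc ->.
  (* [key] asks for a radius strictly larger than |h|, whence the factor 2. *)
  rewrite (le_trans (key h (2 * normc h) _ _))//; [lra|lra|].
  have -> : C * (2 * normc h) ^+ 2 = (normc h * (4 * C)) * normc h by ring.
  rewrite mulrDr mulr1 in he; by rewrite ler_wpM2r ?(ltW nh)//; lra.
split.
- by have [l ld] := fder z z1; rewrite (cderiv_derive1 ld).
- by rewrite [derive1n 2 f z](cderiv_derive1 E2).
- exists C, d; split=> // h hd.
  rewrite [derive1n 2 f z](cderiv_derive1 E2) E1.
  have := H (normc h) h 0 hd (lexx _).
  rewrite normc0 => /(_ (normc_ge0 _)).
  rewrite addr0 expr0n !subr0 -mulrA -exprSr.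
  by rewrite (_ : 2 * c 2%N / 2 = c 2%N)//; field.
Qed.

Lemma normc_near_continuous (f : R[i] -> R[i]) z : {for z, continuous f} ->
  forall e, 0 < e -> exists2 d, 0 < d & forall w, normc (w - z) < d ->
    normc (f w) < normc (f z) + e.
Proof.
move=> /continuousCP cf e /cf[d d0 H]; exists d => // w /H fe.
by rewrite -[f w](subrK (f z)) addrC (le_lt_trans (le_normcD _ _))// ltrD2l.
Qed.

(* Compactness of the square [-1, 1]^2, covered by neighbourhoods on which f is
   bounded or which avoid the closed disk of radius r. *)
Lemma continuous_disk_bounded (f : R[i] -> R[i]) (r : R) :
  (forall w, unit_disk w -> {for w, continuous f}) -> r < 1 ->
  exists2 K, 0 <= K & forall w, normc w <= r -> normc (f w) <= K.
Proof.
move=> fc r1.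
have cK : compact (`[(-1 : R), 1] `*` `[(-1 : R), 1]).
  by apply: compact_setX; exact: segment_compact.
have := proj1 (@compact_near_coveringP _ _) cK R (@pinfty_nbhs R)
  (fun K ab => normc (ab.1 +i* ab.2) <= r -> normc (f (ab.1 +i* ab.2)) <= K) _.
have nearC (a b e : R) : 0 < e -> \forall ab \near (a, b),
    normc ((ab.1 +i* ab.2) - (a +i* b)) < e.
  move=> e0; have e2 : 0 < e / 2 by rewrite divr_gt0.
  exists (ball a (e / 2), ball b (e / 2)); first by split; exact: nbhsx_ballx.
  move=> [a' b'] [h1 h2].
  have {}h1 : `|a' - a| < e / 2 by move: h1; rewrite -ball_normE /= distrC.
  have {}h2 : `|b' - b| < e / 2 by move: h2; rewrite -ball_normE /= distrC.
  by rewrite (le_lt_trans (normc_le _))// [ltRHS]splitr ltrD.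
case.
  move=> [a b] _; have [ab1|ab1] := ltP (normc (a +i* b)) 1.
    have abD : unit_disk (a +i* b) by rewrite unit_diskE.
    have [d d0 H] := normc_near_continuous (fc _ abD) ltr01.
    exists ([set ab | normc ((ab.1 +i* ab.2) - (a +i* b)) < d],
       [set K | normc (f (a +i* b)) + 1 < K]).
      by split; [exact: nearC|apply: nbhs_pinfty_gt; rewrite num_real].
    by move=> [[a' b'] K] [/H h1 h2] _; exact/ltW/(lt_trans h1).
  exists ([set ab | normc ((ab.1 +i* ab.2) - (a +i* b)) < 1 - r], setT).
    by split; [apply: nearC; rewrite subr_gt0|exact: filterT].
  move=> [[a' b'] K] [h1 _] h2.
  have {}h1 : normc ((a' +i* b') - (a +i* b)) < 1 - r := h1.
  have {}h2 : normc (a' +i* b') <= r := h2.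
  have := le_normcB (a' +i* b') ((a' +i* b') - (a +i* b)).
  rewrite [_ - (_ - _)](_ : _ = a +i* b); first by move=> h3; lra.
  by ring.
move=> M [_ H]; exists (Num.max 0 (M + 1)); first by rewrite le_max lexx.
move=> w wr; rewrite le_max; apply/orP; right.
have : forall ab, (`[(-1 : R), 1] `*` `[(-1 : R), 1]) ab ->
    normc (ab.1 +i* ab.2) <= r -> normc (f (ab.1 +i* ab.2)) <= M + 1.
  by apply: H; rewrite ltrDl.
case: w wr => a b wr /(_ (a, b)); apply => //.
have ha : `|a| <= normc (a +i* b) := normRe_le (a +i* b).
have hb : `|b| <= normc (a +i* b) := normIm_le (a +i* b).
have {}wr : normc (a +i* b) <= r := wr.
by split; rewrite /= in_itv /= -ler_norml; lra.
Qed.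

(** The constant term cancels in p u - p v, so the tail estimate from degree 1 on covers the whole
    difference. *)
Lemma disk_series_lipschitz (a : nat -> R[i]) (p : R[i] -> R[i]) (r : R) :
  (forall z, unit_disk z -> series (fun n => a n * z ^+ n) @ \oo --> p z) ->
  0 < r -> r < 1 ->
  exists2 L, 0 <= L & forall u v, normc u <= r -> normc v <= r ->
    normc (p u - p v) <= L * normc (u - v).
Proof.
move=> ap r0 r1; have [s rs s1] : exists2 s, r < s & s < 1.
  by exists ((r + 1) / 2); lra.
have s0 : 0 < s by lra.
have ns : normc s%:C = s by rewrite normcC gtr0_norm.
have [|K cK] := @cvg_power_series_bounded _ a s%:C.
  by apply/cvg_ex; exists (p s%:C); apply: ap; rewrite unit_diskE ns.
rewrite ns in cK.
have [C C0 HC] := power_series_lipschitz 0 r0 rs cK.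
exists C => // u v ur vr.
have cv : series (fun n => a n * u ^+ n) - series (fun n => a n * v ^+ n) @ \oo
    --> p u - p v.
  by apply: cvgB; apply: ap; rewrite unit_diskE; lra.
apply: normc_lim_le cv _.
exists 1%N => // N /= N1.
have := HC N _ _ _ (lexx r) ur vr; rewrite expr0 mulr1; congr (_ <= _); congr normc.
rewrite !fctE /series /=.
under eq_bigr do rewrite mulrBr.
have -> : (\sum_(0 <= k < N) a k * u ^+ k - \sum_(0 <= k < N) a k * v ^+ k) =
    \sum_(0 <= k < 1) (a k * u ^+ k - a k * v ^+ k) +
    \sum_(1 <= k < N) (a k * u ^+ k - a k * v ^+ k).
  by rewrite -sumrB -big_cat_nat.
by rewrite big_nat1 !expr0 subrr add0r.
Qed.

End analytic_functions.

(** * Differentiable curves in the complex plane *)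

Section curves.
Variable R : realType.
Implicit Types (g : R -> R[i]) (v : R[i]) (t T e M : R).

Lemma has_time_derivativeP g t v : has_time_derivative g t v <->
  forall e, 0 < e -> exists2 d, 0 < d & forall h, 0 <= t + h -> `|h| < d ->
    normc (g (t + h) - g t - v * h%:C) <= e * `|h|.
Proof.
rewrite /has_time_derivative.
have quo h : h != 0 -> (v - (g (t + h) - g t) / h%:C) * h%:C =
    - (g (t + h) - g t - v * h%:C).
  by move=> h0; rewrite mulrBl divfK ?opprB// -[0]/(0%:C) (inj_eq (@complexI R)).
split=> [/cvgCP H e /H|H].
  rewrite near_withinE => /nbhs_ballP[d /= d0 {}H]; exists d => // h th hd.
  have [->|h0] := eqVneq h 0.
    by rewrite addr0 subrr mulr0 subrr normc0 normr0 mulr0.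
  rewrite -normcN -quo// normcM normcC ler_wpM2r// ltW//; apply: H => //.
  by rewrite -ball_normE /= sub0r normrN.
apply: (@cvgC_normc _ _ (within [set h | 0 <= t + h] (0 : R)^')) => e e0.
have e2 : 0 < e / 2 by rewrite divr_gt0.
have [d d0 {}H] := H _ e2.
rewrite near_withinE; apply/nbhs_ballP; exists d => // h.
rewrite -ball_normE /= sub0r normrN => hd h0 th.
have h0' : 0 < `|h| by rewrite normr_gt0.
rewrite -(ltr_pM2r h0') -normcC -normcM quo// normcN normcC.
by rewrite (le_lt_trans (H _ th hd))// ltr_pM2r//; lra.
Qed.

Lemma has_time_derivative_continuous g t v : has_time_derivative g t v ->
  forall e, 0 < e -> exists2 d, 0 < d & forall s, 0 <= s -> `|s - t| < d ->
    normc (g s - g t) < e.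
Proof.
move=> /has_time_derivativeP /(_ _ ltr01)[d d0 H] e e0.
have k0 : 0 < 1 + normc v by rewrite ltr_wpDr ?normc_ge0.
exists (Num.min d (e / (1 + normc v))); first by rewrite lt_min d0 divr_gt0.
move=> s s0; rewrite lt_min ltr_pdivlMr// => /andP[sd se].
have := H (s - t); rewrite (addrC t) subrK mul1r => /(_ s0 sd) {}H.
rewrite -[g s - g t](subrK (v * (s - t)%:C)).
rewrite (le_lt_trans (le_normcD _ _))// normcM normcC.
by rewrite (le_lt_trans _ se)// [leRHS]mulrDr mulr1 lerD// mulrC.
Qed.

Lemma has_time_derivative_sub_linear g t v w : has_time_derivative g t v ->
  has_time_derivative (fun s => g s - s%:C * w) t (v - w).
Proof.
move=> /has_time_derivativeP H; apply/has_time_derivativeP => e /H[d d0 {}H].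
exists d => // h th hd; have := H h th hd; congr (_ <= _); congr normc.
by rewrite raddfD /=; ring.
Qed.

(** The mean value theorem has no equality for complex curves, so it is applied to the real function
    Re (c g) with c the conjugate of g b - g a. Its increment is |g b - g a|^2, and one factor
    cancels. *)
Lemma curve_mean_value g (dg : R -> R[i]) a b M : 0 <= a -> a <= b -> 0 <= M ->
  (forall t, a <= t <= b -> has_time_derivative g t (dg t)) ->
  (forall t, a < t < b -> normc (dg t) <= M) ->
  normc (g b - g a) <= M * (b - a).
Proof.
move=> a0; rewrite le_eqVlt => /predU1P[->|ab] M0 dgP dgM.
  by rewrite !subrr normc0 mulr0.
pose c := (g b - g a)^*.
have [gab|gab] := eqVneq (normc (g b - g a)) 0.
  by rewrite gab mulr_ge0// subr_ge0 ltW.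
have gab0 : 0 < normc (g b - g a) by rewrite lt_def gab normc_ge0.
have nc : normc c = normc (g b - g a).
  by apply: (@complexI R); rewrite -!normC_normc normcJ.
pose u t := complex.Re (c * g t).
have udist s t : u s - u t = complex.Re (c * (g s - g t)).
  by rewrite mulrBr raddfB.
have uder t : t \in `]a, b[%R -> is_derive t 1 u (complex.Re (c * dg t)).
  rewrite in_itv /= => tab.
  have t0 : 0 < t by rewrite (le_lt_trans a0)//; case/andP: tab.
  have ucv : (fun h => h^-1 *: (u (h *: 1 + t) - u t)) @ 0^' -->
      complex.Re (c * dg t).
    apply/cvgrPdist_lt => e e0.
    have tab' : a <= t <= b by case/andP: tab => /ltW -> /ltW ->.
    have := proj1 (has_time_derivativeP _ _ _) (dgP t tab') (e / 2 / normc c).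
    rewrite nc !divr_gt0// => /(_ isT)[d d0 H].
    apply/nbhs_ballP; exists (Num.min d t); first by rewrite /= lt_min d0.
    move=> h; rewrite -ball_normE /= sub0r normrN lt_min => /andP[hd ht] h0.
    have h0' : 0 < `|h| by rewrite normr_gt0.
    rewrite [h *: 1]mulr1 udist -(ltr_pM2r h0') -normrM mulrBl.
    rewrite /GRing.scale /= [X in _ - X]mulrAC mulVf// mul1r.
    have -> : complex.Re (c * dg t) * h - complex.Re (c * (g (h + t) - g t)) =
        - complex.Re (c * (g (t + h) - g t - dg t * h%:C)).
      rewrite (addrC h); move: (g (t + h) - g t) => A.
      rewrite [c * (A - _)]mulrBr raddfB opprB mulrA; congr (_ - _).
      by case: (c * dg t) => x y /=; rewrite mulr0 subr0.
    rewrite normrN (le_lt_trans (normRe_le _))// normcM nc.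
    have := H h _ hd; have th : 0 <= t + h.
      by move: ht; rewrite ltr_norml; lra.
    move=> /(_ th) H'.
    rewrite (le_lt_trans (ler_wpM2l (normc_ge0 _) H'))//.
    rewrite mulrA ltr_pM2r//.
    by rewrite mulrC divfK//; lra.
  by apply: DeriveDef; [apply/cvg_ex; eexists; exact: ucv|exact: cvg_lim ucv].
have ucont : {within `[a, b], continuous u}.
  apply/subspace_continuousP => t /=; rewrite in_itv /= => tab.
  apply/cvgrPdist_lt => e e0.
  have := has_time_derivative_continuous (dgP t tab) (e := e / normc c).
  rewrite nc divr_gt0// => /(_ isT)[d d0 H].
  rewrite near_withinE; apply/nbhs_ballP; exists d => // s.
  rewrite -ball_normE /= distrC => st; rewrite in_itv /= => /andP[as_ _].
  rewrite distrC udist (le_lt_trans (normRe_le _))// normcM nc mulrC.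
  by rewrite -ltr_pdivlMr//; apply: H => //; exact: le_trans as_.
have [s sab] := MVT ab uder ucont.
rewrite udist => E.
have {}E : normc (g b - g a) ^+ 2 = complex.Re (c * dg s) * (b - a).
  have E2 : (g b - g a) * c = (normc (g b - g a) ^+ 2)%:C.
    by rewrite -sqr_normc normC_normc -rmorphXn.
  by rewrite -E mulrC E2.
rewrite -(ler_pM2l gab0) -expr2 E mulrA ler_wpM2r ?subr_ge0 ?(ltW ab)//.
rewrite (le_trans (ler_norm _))// (le_trans (normRe_le _))// normcM nc.
apply: ler_wpM2l; first exact: normc_ge0.
by apply: dgM; move: sab; rewrite in_itv.
Qed.

(* A first exit time from the ball of radius d would have to occur after T,
   since up to it the speed is at most M. *)
Lemma curve_stays_close g (dg : R -> R[i]) T M d : 0 <= M -> M * T < d ->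
  (forall t, 0 <= t <= T -> has_time_derivative g t (dg t)) ->
  (forall t, 0 <= t <= T -> normc (g t - g 0) < d -> normc (dg t) <= M) ->
  forall t, 0 <= t <= T -> normc (g t - g 0) <= M * t.
Proof.
move=> M0 MT dgP dgM.
suff close t : 0 <= t <= T -> normc (g t - g 0) < d.
  move=> t /andP[t0 tT]; rewrite -[X in _ * X]subr0.
  apply: (@curve_mean_value g dg) => // s /andP[s0 st].
    by apply: dgP; rewrite s0 (le_trans st).
  have sT : 0 <= s <= T by rewrite ltW//= (le_trans (ltW st)).
  by apply: dgM => //; exact: close.
move=> tT; rewrite ltNge; apply/negP => dgt.
pose S := [set s | 0 <= s <= T /\ d <= normc (g s - g 0)].
have St : S t by [].
have lbS : lbound S 0 by move=> s [/andP[]].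
have hiS : has_inf S by split; [exists t|exists 0].
pose s := inf S.
have s0 : 0 <= s by apply: lb_le_inf => //; exists t.
have sle x : S x -> s <= x by move=> Sx; apply: ge_inf => //; exists 0.
have sT : s <= T by apply: (le_trans (sle _ St)); case/andP: tT.
have gs : normc (g s - g 0) <= M * s.
  rewrite -[X in _ * X]subr0.
  apply: (@curve_mean_value g dg) => // x /andP[x0 xs].
    by apply: dgP; rewrite x0 (le_trans xs).
  have xT : 0 <= x <= T by rewrite ltW//= (le_trans (ltW xs)).
  apply: dgM => //; rewrite ltNge; apply/negP => dx.
  by have := sle x (conj xT dx); rewrite leNgt xs.
have e0 : 0 < d - normc (g s - g 0).
  rewrite subr_gt0 (le_lt_trans gs)// (le_lt_trans _ MT)//.
  by rewrite ler_wpM2l.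
have ss : 0 <= s <= T by rewrite s0.
have [h h0 H] := has_time_derivative_continuous (dgP s ss) e0.
have [x Sx] := inf_adherent h0 hiS.
rewrite -/s => xsh; have sx := sle _ Sx.
case: Sx => /andP[x0 _]; apply/negP; rewrite -ltNge.
have -> : g x - g 0 = (g x - g s) + (g s - g 0) by ring.
rewrite (le_lt_trans (le_normcD _ _))// -ltrBrDr; apply: H => //.
by rewrite ger0_norm ?subr_ge0// ltrBlDl.
Qed.

(** Heine's theorem, with continuity relative to [0, T]. Compactness is used as a near-covering
    along the filter 0^+, which makes one d admissible at all points. *)
Lemma uniform_continuity_segment g T :
  (forall s, 0 <= s <= T -> forall e, 0 < e -> exists2 d, 0 < d &
     forall s', 0 <= s' <= T -> `|s' - s| < d -> normc (g s' - g s) < e) ->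
  forall e, 0 < e -> exists2 d, 0 < d & forall s s',
    0 <= s <= T -> 0 <= s' <= T -> `|s' - s| < d -> normc (g s' - g s) < e.
Proof.
move=> gc e e0; have e2 : 0 < e / 2 by rewrite divr_gt0.
have := proj1 (@compact_near_coveringP _ _) (@segment_compact R 0 T) R (0 : R)^'+
  (fun d s => 0 <= s <= T -> forall s', 0 <= s' <= T -> `|s' - s| < d ->
     normc (g s' - g s) < e) _.
case.
  move=> s; rewrite /= in_itv /= => sT.
  have [d d0 H] := gc s sT _ e2.
  exists (ball s (d / 2), [set x | x < d / 2]).
    split; first by apply: nbhsx_ballx; rewrite divr_gt0.
    by apply: nbhs_right_lt; rewrite divr_gt0.
  move=> [x k] [/=]; rewrite -ball_normE /= => xs kd xT y yT yx.
  have -> : g y - g x = (g y - g s) - (g x - g s) by ring.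
  rewrite (le_lt_trans (le_normcB _ _))// [ltRHS]splitr ltrD// H//.
    have -> : y - s = (y - x) + (x - s) by ring.
    rewrite (le_lt_trans (ler_normD _ _))// [ltRHS]splitr ltrD//.
      exact: lt_trans kd.
    by rewrite distrC.
  by rewrite distrC (lt_trans xs)//; lra.
move=> d /= d0 H; exists (d / 2); first by rewrite divr_gt0.
have dd : (0 : R) < d / 2 by rewrite divr_gt0.
move=> s s' sT s'T ss'.
apply: (H (d / 2)) ss' => //.
by rewrite /ball_ /= sub0r normrN gtr0_norm//; lra.
Qed.

End curves.

(** * Convergence of the explicit Euler scheme *)

Section euler_scheme.
Variable R : realType.

Fixpoint euler (V : R -> R[i] -> R[i]) (h : R) (z : R[i]) (n : nat) : R[i] :=
  if n is m.+1 then
    let x := euler V h z m in x + h%:C * V (m%:R * h) x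
  else z.

Variables (V : R -> R[i] -> R[i]) (z : R[i]) (T r M L : R).
Hypotheses (T0 : 0 <= T) (M0 : 0 <= M) (L0 : 0 <= L).
Hypothesis VM : forall t u, 0 <= t <= T -> normc u <= r -> normc (V t u) <= M.
Hypothesis VL : forall t u v, 0 <= t <= T -> normc u <= r -> normc v <= r ->
  normc (V t u - V t v) <= L * normc (u - v).
Hypothesis zr : normc z + M * T <= r.

Lemma grid_mem h n j : 0 <= h -> n%:R * h = T -> (j <= n)%N ->
  0 <= j%:R * h <= T.
Proof. by move=> h0 <- jn; rewrite mulr_ge0//= ler_wpM2r// ler_nat. Qed.

(** Keeps the iterates in the disk of radius r, where the bounds on [V] hold. *)
Lemma euler_bounded h n j : 0 <= h -> n%:R * h = T -> (j <= n)%N ->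
  normc (euler V h z j) <= normc z + M * (j%:R * h) <= r.
Proof.
move=> h0 nh jn; apply/andP; split; last first.
  rewrite (le_trans _ zr)// lerD2l ler_wpM2l//.
  by case/andP: (grid_mem h0 nh jn).
elim: j jn => [|j IH] jn /=; first by rewrite mul0r mulr0 addr0.
have jT := grid_mem h0 nh (ltnW jn).
have xr : normc (euler V h z j) <= r.
  rewrite (le_trans (IH (ltnW jn)))// (le_trans _ zr)// lerD2l ler_wpM2l//.
  by case/andP: jT.
rewrite (le_trans (le_normcD _ _))// normcM normcC ger0_norm//.
have := VM jT xr => /(ler_wpM2l h0) hV.
have := IH (ltnW jn); rewrite -natr1 mulrDl mul1r mulrDr; lra.
Qed.

(** The speed along the solution is only continuous in time, so no second derivative is available
    and no rate is claimed. Uniform continuity of the speed makes each one-step defect a small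
    multiple of h, and the Lipschitz bound propagates it by the discrete Gronwall factor (1 + h L)^n
    <= exp(T L). *)
Lemma euler_cvg (g : R -> R[i]) : g 0 = z ->
  (forall t, 0 <= t <= T -> has_time_derivative g t (V t (g t))) ->
  (forall t, 0 <= t <= T -> normc (g t) <= r) ->
  (forall s, 0 <= s <= T -> forall e, 0 < e -> exists2 d, 0 < d &
     forall s', 0 <= s' <= T -> `|s' - s| < d ->
       normc (V s' (g s') - V s (g s)) < e) ->
  (fun n => euler V (T / n.+1%:R) z n.+1) @ \oo --> g T.
Proof.
move=> g0 dg gr Vc.
apply: (@cvgC_normc _ _ \oo) => e e0.
(* Chosen so that the accumulated error T (e / k) exp(T L) is less than e; the 1 makes this strict
   and k positive even for T = 0. *)
pose k := T * expR (T * L) + 1.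
have k0 : 0 < k by rewrite ltr_wpDl// mulr_ge0// expR_ge0.
have ek : 0 < e / k by rewrite divr_gt0.
have [d d0 Vd] := uniform_continuity_segment Vc ek.
have [N TN] : exists N : nat, T / d < N%:R.
  by exists (Num.bound (T / d)); rewrite archi_boundP// divr_ge0// ltW.
exists N => // n /= Nn.
set h := T / n.+1%:R.
have h0 : 0 <= h by rewrite divr_ge0.
have nh : n.+1%:R * h = T by rewrite mulrC divfK// pnatr_eq0.
have hd : h < d.
  rewrite ltr_pdivrMr ?ltr0n// mulrC -ltr_pdivrMr// (lt_le_trans TN)//.
  by rewrite ler_nat (leq_trans Nn).
have step j : (j <= n)%N ->
    normc (g (j.+1%:R * h) - g (j%:R * h) - h%:C * V (j%:R * h) (g (j%:R * h)))
      <= e / k * h.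
  move=> jn; pose s := j%:R * h; pose V0 := V s (g s).
  have sT : 0 <= s <= T by apply: grid_mem nh _ => //; exact: leqW.
  have s1T : 0 <= s + h <= T.
    have -> : s + h = j.+1%:R * h by rewrite -natr1 mulrDl mul1r.
    exact: grid_mem nh _.
  have -> : j.+1%:R * h = s + h by rewrite -natr1 mulrDl mul1r.
  rewrite -/s -/V0.
  have -> : g (s + h) - g s - h%:C * V0 =
      (g (s + h) - (s + h)%:C * V0) - (g s - s%:C * V0).
    by rewrite rmorphD /=; ring.
  rewrite [X in _ <= _ * X](_ : h = (s + h) - s); last by ring.
  (* Subtracting the uniform motion of speed [V0] turns the one-step defect into the increment of a
     curve whose speed is at most e / k. *)
  apply: (@curve_mean_value _ (fun t => g t - t%:C * V0)
      (fun t => V t (g t) - V0)).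
  - by case/andP: sT.
  - by rewrite lerDl.
  - exact: ltW.
  - move=> t /andP[st th]; apply: has_time_derivative_sub_linear; apply: dg.
    case/andP: sT => s0 _; case/andP: s1T => _ sh.
    by rewrite (le_trans s0)// (le_trans th).
  - move=> t /andP[st th]; apply/ltW/Vd => //.
      case/andP: sT => s0 _; case/andP: s1T => _ sh.
      by rewrite (le_trans s0 (ltW st)) (le_trans (ltW th)).
    by rewrite gtr0_norm ?subr_gt0//; lra.
have err j : (j <= n.+1)%N -> normc (g (j%:R * h) - euler V h z j) <=
    j%:R * h * (e / k) * (1 + h * L) ^+ j.
  elim: j => [|j IH] jn; first by rewrite !mul0r g0 /= subrr normc0.
  have jT := grid_mem h0 nh (ltnW jn).
  have xr : normc (euler V h z j) <= r.
    by case/andP: (euler_bounded h0 nh (ltnW jn)); exact: le_trans.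
  have -> : g (j.+1%:R * h) - euler V h z j.+1 =
     (g (j.+1%:R * h) - g (j%:R * h) - h%:C * V (j%:R * h) (g (j%:R * h))) +
     ((g (j%:R * h) - euler V h z j) +
      h%:C * (V (j%:R * h) (g (j%:R * h)) - V (j%:R * h) (euler V h z j))).
    by move=> /=; ring.
  rewrite (le_trans (le_normcD _ _))//.
  have h1 := step j jn.
  have h2 : normc ((g (j%:R * h) - euler V h z j) +
      h%:C * (V (j%:R * h) (g (j%:R * h)) - V (j%:R * h) (euler V h z j))) <=
      (1 + h * L) * normc (g (j%:R * h) - euler V h z j).
    rewrite (le_trans (le_normcD _ _))// mulrDl mul1r lerD2l normcM normcC.
    by rewrite ger0_norm// -mulrA ler_wpM2l// VL// gr.
  rewrite (le_trans (lerD h1 h2))//.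
  have hL : 1 <= 1 + h * L by rewrite lerDl mulr_ge0.
  have hL0 : 0 <= 1 + h * L by exact: le_trans hL.
  have h3 := ler_wpM2l hL0 (IH (ltnW jn)).
  have h4 : e / k * h <= h * (e / k) * (1 + h * L) ^+ j.+1.
    rewrite [leLHS]mulrC; apply: ler_peMr; first by rewrite mulr_ge0// ltW.
    exact: exprn_ege1.
  rewrite (le_trans (lerD h4 h3))// le_eqVlt; apply/orP; left; apply/eqP.
  by rewrite exprS -natr1; ring.
have := err n.+1 (leqnn _); rewrite nh => /le_lt_trans; apply.
apply: (@le_lt_trans _ _ (T * (e / k) * expR (T * L))).
  apply: ler_wpM2l; first by rewrite mulr_ge0// ltW.
  rewrite -[X in expR (X * L)]nh -mulrA expRM_natl.
  rewrite lerXn2r ?nnegrE ?expR_ge0// ?expR_ge1Dx//.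
  by rewrite addr_ge0// mulr_ge0.
have -> : T * (e / k) * expR (T * L) = e * (T * expR (T * L)) / k by ring.
by rewrite ltr_pdivrMr// ltr_pM2l// ltrDl.
Qed.

End euler_scheme.

(** * Measurability of complex random variables *)

Section complex_measurability.
Context {d : measure_display} {Omega : measurableType d} {R : realType}.
Implicit Types X Y : Omega -> R[i].

Definition cmeasurable X := measurable_fun setT (fun w => complex.Re (X w)) /\
  measurable_fun setT (fun w => complex.Im (X w)).

Lemma cmeasurable_cst (c : R[i]) : cmeasurable (cst c).
Proof. by split; exact: measurable_cst. Qed.

Lemma cmeasurableD X Y : cmeasurable X -> cmeasurable Y ->
  cmeasurable (fun w => X w + Y w).
Proof.
move=> [X1 X2] [Y1 Y2]; split.
  by apply: (eq_measurable_fun (fun w => complex.Re (X w) + complex.Re (Y w)));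
    [move=> w _; rewrite raddfD|exact: measurable_funD].
by apply: (eq_measurable_fun (fun w => complex.Im (X w) + complex.Im (Y w)));
    [move=> w _; rewrite raddfD|exact: measurable_funD].
Qed.

Lemma cmeasurableM X Y : cmeasurable X -> cmeasurable Y ->
  cmeasurable (fun w => X w * Y w).
Proof.
move=> [X1 X2] [Y1 Y2]; split.
  apply: (eq_measurable_fun (fun w => complex.Re (X w) * complex.Re (Y w) -
     complex.Im (X w) * complex.Im (Y w))).
    by move=> w _; case: (X w) => ? ?; case: (Y w).
  by apply: measurable_funB; exact: measurable_funM.
apply: (eq_measurable_fun (fun w => complex.Re (X w) * complex.Im (Y w) +
     complex.Im (X w) * complex.Re (Y w))).
  by move=> w _; case: (X w) => ? ?; case: (Y w).
by apply: measurable_funD; exact: measurable_funM.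
Qed.

Lemma cmeasurable_cvg (X_ : nat -> Omega -> R[i]) X :
  (forall n, cmeasurable (X_ n)) -> (forall w, X_ ^~ w @ \oo --> X w) ->
  cmeasurable X.
Proof.
move=> mX cX; split.
  apply: (@measurable_fun_cvg _ _ _ _ (fun n w => complex.Re (X_ n w))) => //.
    by move=> n; case: (mX n).
  by move=> w _; have [] := proj1 (cvgC_parts _ _) (cX w).
apply: (@measurable_fun_cvg _ _ _ _ (fun n w => complex.Im (X_ n w))) => //.
  by move=> n; case: (mX n).
by move=> w _; have [] := proj1 (cvgC_parts _ _) (cX w).
Qed.

Lemma cmeasurable_expi (Y : Omega -> R) : measurable_fun setT Y ->
  cmeasurable (fun w => expi (Y w)).
Proof.
move=> mY; split.
  apply: (measurableT_comp _ mY); apply: continuous_measurable_fun.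
  exact: continuous_cos.
apply: (measurableT_comp _ mY); apply: continuous_measurable_fun.
exact: continuous_sin.
Qed.

(* [f \o X] is the limit of [f] evaluated on ever finer grid approximations of
   [X], and those take countably many values. *)
Lemma cmeasurable_comp (f : R[i] -> R[i]) X : cmeasurable X ->
  (forall w, {for X w, continuous f}) -> cmeasurable (fun w => f (X w)).
Proof.
move=> [X1 X2] fX.
pose r n (x : R) : R := (Num.floor (x * n.+1%:R))%:~R / n.+1%:R.
pose Xn n w := r n (complex.Re (X w)) +i* r n (complex.Im (X w)).
have rx n (x : R) : `|r n x - x| <= n.+1%:R^-1.
  have n0 : 0 < n.+1%:R :> R by rewrite ltr0n.
  rewrite ler_norml; apply/andP; split.
    rewrite lerBrDr addrC -(ler_pM2r n0) mulrBl mulVf ?gt_eqF// divfK ?gt_eqF//.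
    by rewrite lerBlDr ltW// -intrD1 floorD1_gt.
  rewrite lerBlDr (@le_trans _ _ x) ?lerDr ?invr_ge0//.
  by rewrite ler_pdivrMr// floor_le.
have mfl n (Y : Omega -> R) (j : int) : measurable_fun setT Y ->
    measurable [set w | Num.floor (Y w * n.+1%:R) = j].
  move=> mY.
  rewrite [X in measurable X](_ : _ =
      (fun w => Y w * n.+1%:R) @^-1` `[j%:~R, (j + 1)%:~R[).
    have mg : measurable_fun setT (fun w => Y w * n.+1%:R).
      by apply: measurable_funM => //; exact: measurable_cst.
    by rewrite -[X in measurable X]setTI; apply: mg.
  apply/seteqP; split => w /=; rewrite in_itv /=.
    by move=> <-; rewrite floor_le floorD1_gt.
  by move=> /floor_def.
apply: (@cmeasurable_cvg (fun n w => f (Xn n w))).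
  move=> n.
  have H (g : R[i] -> R) : measurable_fun setT (fun w => g (Xn n w)).
    move=> _ U mU; rewrite setTI.
    pose gr (ij : int * int) := (ij.1%:~R / n.+1%:R) +i* (ij.2%:~R / n.+1%:R) : R[i].
    rewrite [X in measurable X](_ : _ = \bigcup_(ij in [set ij | U (g (gr ij))])
       ([set w | Num.floor (complex.Re (X w) * n.+1%:R) = ij.1] `&`
        [set w | Num.floor (complex.Im (X w) * n.+1%:R) = ij.2])).
      rewrite bigcup_mkcond; apply: countable_bigcupT_measurable.
        exact: countableP.
      by move=> ij; case: ifP => // _; apply: measurableI; exact: mfl.
    apply/seteqP; split => w /=.
      move=> Uw; exists (Num.floor (complex.Re (X w) * n.+1%:R),
         Num.floor (complex.Im (X w) * n.+1%:R)) => //.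
    by move=> [[i j] Ug [/= Ei Ej]]; move: Ug; rewrite /= /gr /= -Ei -Ej.
  by split; [exact: (H (fun z => complex.Re (f z)))|exact: (H (fun z => complex.Im (f z)))].
move=> w; have XnX : Xn ^~ w @ \oo --> X w.
  have rc (x : R) : r ^~ x @ \oo --> x.
    apply/cvgrPdist_lt => e e0.
    have := near_infty_natSinv_lt (PosNum e0); apply: filterS => n /=.
    by rewrite distrC; exact/le_lt_trans/rx.
  apply/cvgC_parts; split; [exact: (rc (complex.Re (X w)))|exact: (rc (complex.Im (X w)))].
exact: (continuous_cvg _ (fX w) XnX).
Qed.

End complex_measurability.

(** * Exponential moments of the normal law *)

Section gaussian_exponential_moments.
Variable R : realType.
Local Notation mu := (@lebesgue_measure R).

(** Change of variables with the Radon-Nikodym derivative, which equals the normal density almost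
    everywhere because both have the same integral over every measurable set. *)
Lemma ge0_integral_normal_prob (m s : R) (f : R -> \bar R) :
  measurable_fun setT f -> (forall x, 0 <= f x)%E ->
  (\int[normal_prob m s]_x f x = \int[mu]_x (f x * (normal_pdf m s x)%:E))%E.
Proof.
move=> mf f0; have dom := normal_prob_dominates m s.
rewrite -(Radon_Nikodym_SigmaFinite.change_of_variables dom f0)//.
have RNint := Radon_Nikodym_SigmaFinite.f_integrable dom.
apply: ae_eq_integral => //.
- by apply: emeasurable_funM => //; exact: measurable_int RNint.
- apply: emeasurable_funM => //; apply/measurable_EFinP.
  exact: measurable_normal_pdf.
- apply: ae_eqe_mul2l; apply: integral_ae_eq => //=.
  + by apply/measurable_EFinP; exact: measurable_normal_pdf.
  + by move=> E _ mE; rewrite -Radon_Nikodym_SigmaFinite.f_integral.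
Qed.

Lemma measurable_expR_scale (l : R) :
  measurable_fun setT (fun x : R => (expR (l * x))%:E).
Proof.
by apply/measurable_EFinP; apply: (measurableT_comp (@measurable_expR R)).
Qed.

(* Completing the square, exp(l x) times the N(0, s^2) density is a constant
   times the N(l s^2, s^2) density. *)
Lemma integral_expR_normal_prob (l s : R) : s != 0 ->
  (\int[normal_prob 0 s]_x (expR (l * x))%:E = (expR (l ^+ 2 * s ^+ 2 / 2))%:E)%E.
Proof.
move=> s0; rewrite ge0_integral_normal_prob; last 2 first.
- exact: measurable_expR_scale.
- by move=> x; rewrite lee_fin expR_ge0.
transitivity (\int[mu]_x ((expR (l ^+ 2 * s ^+ 2 / 2))%:E *
    (normal_pdf (l * s ^+ 2) s x)%:E))%E.
  apply: eq_integral => x _; rewrite -!EFinM; congr EFin.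
  rewrite !normal_pdfE// /normal_fun mulrCA [RHS]mulrCA; congr (_ * _).
  by rewrite -!expRD; congr expR; field.
rewrite ge0_integralZl//.
- by rewrite integral_normal_pdf mule1.
- by apply/measurable_EFinP; exact: measurable_normal_pdf.
- by move=> x _; rewrite lee_fin normal_pdf_ge0.
Qed.

End gaussian_exponential_moments.

(** * Inequalities for sinh and cosh - 1 *)

Section cosh_sinh.
Variable R : realType.
Implicit Types x : R.

Definition sinhR x := (expR x - expR (- x)) / 2.
Definition coshm1 x := (expR x + expR (- x)) / 2 - 1.

(** With a = exp(x / 2) and b = exp(- x / 2) one has a b = 1, so cosh x - 1 = (a - b)^2 / 2; for x
    >= 0, a >= 1 + x / 2 and b <= 1. The constant 1/8 instead of 1/2 is the price of these crude
    bounds. The lemma converts powers of |x| into powers of cosh x - 1. *)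
Lemma coshm1_ge x : x ^+ 2 / 8 <= coshm1 x.
Proof.
wlog x0 : x / 0 <= x => [H|].
  have [x0|/ltW x0] := leP 0 x; first exact: H.
  have := H (- x); rewrite oppr_ge0 => /(_ x0).
  by rewrite sqrrN /coshm1 opprK (addrC (expR (- x))).
pose a := expR (x / 2); pose b := expR (- (x / 2)).
have ab : a * b = 1 by rewrite /a /b expRxMexpNx_1.
have a1 : 1 + x / 2 <= a by exact: expR_ge1Dx.
have b0 : 0 < b by exact: expR_gt0.
have Ea : expR x = a ^+ 2 by rewrite -expRM_natl; congr expR; field.
have Eb : expR (- x) = b ^+ 2 by rewrite -expRM_natl; congr expR; field.
have -> : coshm1 x = (a - b) ^+ 2 / 2.
  by rewrite /coshm1 Ea Eb sqrrB ab; field.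
have a0 : 1 <= a by lra.
have b1 : b <= 1.
  by rewrite /b expR_le1 oppr_le0 divr_ge0.
have d : x / 2 <= a - b by lra.
have : (x / 2) ^+ 2 <= (a - b) ^+ 2.
  rewrite lerXn2r ?nnegrE//; lra.
rewrite [(x / 2) ^+ 2](_ : _ = x ^+ 2 / 4); last by field.
lra.
Qed.

Lemma coshm1_ge0 x : 0 <= coshm1 x.
Proof. by rewrite (le_trans _ (coshm1_ge x))// divr_ge0// sqr_ge0. Qed.

(** Linearized so that the mean of the square is read off from exponential moments. *)
Lemma sqr_coshm1 x : coshm1 x ^+ 2 =
  (expR (2 * x) + expR (- 2 * x)) / 4 + 3 / 2 - (expR x + expR (- x)).
Proof.
have E := expRxMexpNx_1 x.
rewrite mulNr -mulrN !expRM_natl /coshm1.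
have -> : ((expR x + expR (- x)) / 2 - 1) ^+ 2 =
  (expR x ^+ 2 + expR (- x) ^+ 2) / 4 + (expR x * expR (- x)) / 2 + 1
    - (expR x + expR (- x)) by field.
by rewrite E; field.
Qed.

Lemma normr_sinhR_le x : `|sinhR x| <= 1 + coshm1 x.
Proof.
have h1 := expR_ge0 x; have h2 := expR_ge0 (- x).
by rewrite ler_norml /sinhR /coshm1; apply/andP; split; lra.
Qed.

(** From exp(- x) >= 1 - x one gets exp(x) (1 - x) <= 1, and the quadratic times 1 - x is 1 + x^2 (1
    - 2 x), at least 1 for x <= 1/2. *)
Lemma expR_le_quadratic x : 0 <= x -> x <= 1 / 2 -> expR x <= 1 + x + 2 * x ^+ 2.
Proof.
move=> x0 x1; have h := expR_ge1Dx (- x).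
have e0 := expR_gt0 x.
have : expR x * (1 - x) <= 1.
  rewrite -[leRHS](expRxMexpNx_1 x); apply: ler_wpM2l; first exact: ltW.
  exact: h.
have h3 : 1 <= (1 + x + 2 * x ^+ 2) * (1 - x).
  have -> : (1 + x + 2 * x ^+ 2) * (1 - x) = 1 + x ^+ 2 * (1 - 2 * x) by ring.
  by rewrite lerDl mulr_ge0 ?sqr_ge0//; lra.
move=> h4; have h5 := le_trans h4 h3.
by rewrite -(@ler_pM2r _ (1 - x))//; lra.
Qed.

End cosh_sinh.

(** * Moments of sinh B_t and cosh B_t - 1 *)

Section brownian_moments.
Context (R : realType) (d : measure_display) (Omega : measurableType d)
  (P : probability Omega R) (F : R -> set (set Omega)) (B : R -> Omega -> R).
Hypotheses (FF : filtration F) (BM : brownian_motion P F B).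

Lemma brownian_measurable t : 0 <= t -> measurable_fun setT (B t).
Proof.
move=> t0 _ U mU; rewrite setTI.
by case: FF => _ + _; apply; last exact: bm_adapted BM _ t0 _ mU.
Qed.

Lemma brownian_expR_integral (l t : R) : 0 < t ->
  (\int[P]_w (expR (l * B t w))%:E = (expR (l ^+ 2 * t / 2))%:E)%E.
Proof.
move=> t0; have mB := brownian_measurable (ltW t0).
have mexp : measurable_fun setT (fun x : R => (expR (l * x))%:E).
  exact: measurable_expR_scale.
have s0 : Num.sqrt t != 0 by rewrite gt_eqF// sqrtr_gt0.
have := integral_expR_normal_prob l s0; rewrite (sqr_sqrtr (ltW t0)) => <-.
have mB' : measurable_fun (setT : set Omega) (B t : Omega -> measurableTypeR R).
  exact: mB.
rewrite -[LHS](@ge0_integral_pushforward _ _ _ (measurableTypeR R) _ (B t) mB' P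
  setT (fun x => (expR (l * x))%:E))//.
apply: eq_measure_integral => A mA _.
have E := bm_normal BM (lexx 0) t0 mA; rewrite subr0 in E.
transitivity (P ((B t \- B 0) @^-1` A)); last exact: E.
rewrite /pushforward; congr (P _); apply/seteqP; split => w /=;
  by rewrite (bm_start BM) subr0.
Qed.

Lemma brownian_expR_integrable (l t : R) : 0 < t ->
  P.-integrable setT (EFin \o (fun w => expR (l * B t w))).
Proof.
move=> t0; apply/integrableP; split.
  apply/measurable_EFinP; apply: measurableT_comp => //.
  by apply: measurable_funM => //; exact/brownian_measurable/ltW.
under eq_integral do rewrite /= ger0_norm ?expR_ge0//.
by rewrite brownian_expR_integral// ltry.
Qed.

Lemma brownian_expR_Rintegral (l t : R) : 0 < t ->
  \int[P]_w expR (l * B t w) = expR (l ^+ 2 * t / 2).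
Proof. by move=> t0; rewrite /Rintegral brownian_expR_integral. Qed.

Variable t : R.
Hypothesis t0 : 0 < t.

(** The factor 1 is written out so that all four functions are instances of exp(l B_t). *)
Let e1 w := expR (1 * B t w).
Let eN1 w := expR (- 1 * B t w).
Let e2 w := expR (2 * B t w).
Let eN2 w := expR (- 2 * B t w).

Let i1 : P.-integrable setT (EFin \o e1). Proof. exact: brownian_expR_integrable. Qed.
Let iN1 : P.-integrable setT (EFin \o eN1). Proof. exact: brownian_expR_integrable. Qed.
Let i2 : P.-integrable setT (EFin \o e2). Proof. exact: brownian_expR_integrable. Qed.
Let iN2 : P.-integrable setT (EFin \o eN2). Proof. exact: brownian_expR_integrable. Qed.

Lemma integrable_cst_prob (c : R) : P.-integrable setT (EFin \o (fun=> c)).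
Proof. exact: finite_measure_integrable_cst. Qed.

Lemma Rintegral_cst_prob (c : R) : \int[P]_w c = c.
Proof.
rewrite Rintegral_cst//; transitivity (c * fine (1%:E : \bar R)); last exact: mulr1.
by congr (_ * fine _); exact: probability_setT.
Qed.

Lemma integrableD_fun (f g : Omega -> R) : P.-integrable setT (EFin \o f) ->
  P.-integrable setT (EFin \o g) -> P.-integrable setT (EFin \o (fun w => f w + g w)).
Proof. by move=> fi gi; exact: (integrableD measurableT fi gi). Qed.

Lemma integrableZ_fun (c : R) (f : Omega -> R) : P.-integrable setT (EFin \o f) ->
  P.-integrable setT (EFin \o (fun w => c * f w)).
Proof. by move=> fi; exact: (integrableZl measurableT c fi). Qed.

Let sinhE : (fun w => sinhR (B t w)) = (fun w => 1 / 2 * e1 w + (- (1 / 2)) * eN1 w).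
Proof.
apply/funext => w; rewrite /e1 /eN1 (mul1r (B t w)) (mulN1r (B t w)).
by rewrite /sinhR; field.
Qed.

Lemma brownian_sinh_integrable : P.-integrable setT (EFin \o (fun w => sinhR (B t w))).
Proof. by rewrite sinhE; apply: integrableD_fun; exact: integrableZ_fun. Qed.

Lemma brownian_sinh_mean : \int[P]_w sinhR (B t w) = 0.
Proof.
rewrite sinhE RintegralD//; [|exact: integrableZ_fun|exact: integrableZ_fun].
by rewrite !RintegralZl// !brownian_expR_Rintegral// sqrrN; ring.
Qed.

Let coshE : (fun w => coshm1 (B t w)) = (fun w => (1 / 2 * e1 w + (1 / 2) * eN1 w) + -1).
Proof.
apply/funext => w; rewrite /e1 /eN1 (mul1r (B t w)) (mulN1r (B t w)).
by rewrite /coshm1; field.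
Qed.

Lemma brownian_coshm1_integrable : P.-integrable setT (EFin \o (fun w => coshm1 (B t w))).
Proof.
rewrite coshE; apply: integrableD_fun; last exact: integrable_cst_prob.
by apply: integrableD_fun; exact: integrableZ_fun.
Qed.

Lemma brownian_coshm1_mean : \int[P]_w coshm1 (B t w) = expR (t / 2) - 1.
Proof.
have i : P.-integrable setT (EFin \o (fun w => 1 / 2 * e1 w + (1 / 2) * eN1 w)).
  by apply: integrableD_fun; exact: integrableZ_fun.
rewrite coshE RintegralD//; last exact: integrable_cst_prob.
rewrite RintegralD//; [|exact: integrableZ_fun|exact: integrableZ_fun].
rewrite !RintegralZl// !brownian_expR_Rintegral// Rintegral_cst_prob.
by rewrite sqrrN expr1n (mul1r t) /=; field.
Qed.

Let cosh2E : (fun w => coshm1 (B t w) ^+ 2) =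
  (fun w => (1 / 4 * e2 w + 1 / 4 * eN2 w) + (- 1 * e1 w + - 1 * eN1 w) + 3 / 2).
Proof.
apply/funext => w; rewrite sqr_coshm1 /e1 /eN1 /e2 /eN2 (mul1r (B t w)) (mulN1r (B t w)).
by field.
Qed.

Lemma brownian_coshm1_sqr_integrable :
  P.-integrable setT (EFin \o (fun w => coshm1 (B t w) ^+ 2)).
Proof.
rewrite cosh2E; apply: integrableD_fun; last exact: integrable_cst_prob.
by apply: integrableD_fun; apply: integrableD_fun; exact: integrableZ_fun.
Qed.

(** The mean is exp(2 t) / 2 - 2 exp(t / 2) + 3 / 2. Inserting exp(2 t) <= 1 + 2 t + 8 t^2, valid
    since 2 t <= 1/2, and exp(t / 2) >= 1 + t / 2 cancels all terms of order 0 and 1 and leaves 4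
    t^2. *)
Lemma brownian_coshm1_sqr_mean_le : t <= 1 / 4 ->
  \int[P]_w (coshm1 (B t w) ^+ 2) <= 4 * t ^+ 2.
Proof.
move=> t1.
have i : P.-integrable setT (EFin \o (fun w => 1 / 4 * e2 w + 1 / 4 * eN2 w)).
  by apply: integrableD_fun; exact: integrableZ_fun.
have j : P.-integrable setT (EFin \o (fun w => - 1 * e1 w + - 1 * eN1 w)).
  by apply: integrableD_fun; exact: integrableZ_fun.
have D c (f g : Omega -> R) : P.-integrable setT (EFin \o f) ->
    P.-integrable setT (EFin \o g) ->
    \int[P]_w (c * f w + c * g w) = c * \int[P]_w f w + c * \int[P]_w g w.
  move=> fi gi; rewrite RintegralD//; [|exact: integrableZ_fun..].
  by rewrite !RintegralZl.
rewrite cosh2E RintegralD//; [|exact: integrableD_fun|exact: integrable_cst_prob].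
rewrite RintegralD// !D// !brownian_expR_Rintegral// Rintegral_cst_prob.
rewrite !sqrrN expr1n (mul1r t) /=.
have -> : 2 ^+ 2 * t / 2 = 2 * t by field.
have t2 : 0 <= 2 * t by rewrite mulr_ge0// ltW.
have t3 : 2 * t <= 1 / 2 by lra.
have h1 := expR_le_quadratic t2 t3.
have h2 := expR_ge1Dx (t / 2).
rewrite [(2 * t) ^+ 2](_ : _ = 4 * t ^+ 2) in h1; last by ring.
lra.
Qed.

End brownian_moments.

(** * Taylor bounds for sin, cos, exp, sinh and cosh *)

Section elementary_expansions.
Variable R : realType.
Implicit Types (x u a C : R).

(** By the mean value theorem the order of vanishing rises by one with the same constant. The factor
    1 / (n + 1) of an integration is given up, so the Taylor bounds obtained by iteration have the
    right order but not sharp constants. *)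
Lemma derive_bound_growth (g dg : R -> R) a C n : g 0 = 0 ->
  (forall x, is_derive x 1 g (dg x)) ->
  (forall x, `|x| <= a -> `|dg x| <= C * `|x| ^+ n) ->
  forall x, `|x| <= a -> `|g x| <= C * `|x| ^+ n.+1.
Proof.
move=> g0 dgP dgC x xa.
have gc : continuous g.
  by move=> y; apply/differentiable_continuous/derivable1_diffP; case: (dgP y).
have bound c : `|c| <= `|x| -> `|dg c * x| <= C * `|x| ^+ n.+1.
  move=> cx; rewrite normrM exprSr mulrA ler_wpM2r//.
  have C0 : 0 <= C * `|x| ^+ n by exact: le_trans (dgC x xa).
  rewrite (le_trans (dgC c (le_trans cx xa)))//.
  (* The hypotheses reveal the sign of C only when x is nonzero. *)
  have [x0|x0] := eqVneq x 0.
    by move: cx; rewrite x0 normr0 normr_le0 => /eqP ->; rewrite normr0.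
  have CC : 0 <= C.
    by move: C0; rewrite pmulr_lge0// exprn_gt0// normr_gt0.
  by rewrite ler_wpM2l// lerXn2r// nnegrE.
have [x0|x0] := leP 0 x.
  have [c] := MVT_segment x0 (fun y _ => dgP y) (continuous_subspaceT gc).
  rewrite in_itv /= g0 !subr0 => /andP[c0 cx] ->; apply: bound.
  by rewrite !ger0_norm.
have [c] := MVT_segment (ltW x0) (fun y _ => dgP y) (continuous_subspaceT gc).
rewrite in_itv /= g0 !sub0r => /andP[xc c0] E.
rewrite -normrN E mulrN normrN; apply: bound.
by rewrite !ler0_norm ?lerN2// ltW.
Qed.

Lemma normr_sin_le u : `|sin u| <= `|u|.
Proof.
rewrite -[leRHS]mul1r -[`|u|]expr1.
apply: (@derive_bound_growth sin cos `|u|) => //; first exact: sin0.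
by move=> x _; rewrite expr0 mulr1 ler_norml cos_geN1 cos_le1.
Qed.

Lemma is_deriveB_fun (f g : R -> R) x df dg :
  is_derive x 1 f df -> is_derive x 1 g dg ->
  is_derive x 1 (fun y => f y - g y) (df - dg).
Proof. by move=> ? ?; exact: is_deriveB. Qed.

Lemma is_derive_half_sqr x : is_derive x 1 (fun y => y ^+ 2 / 2) x.
Proof.
have -> : (fun y : R => y ^+ 2 / 2) = 2^-1 *: (id ^+ 2).
  by apply/funext => y; rewrite mulrC.
by apply: is_derive_eq; rewrite /GRing.scale /=; field.
Qed.

Lemma is_derive_cosB1 x : is_derive x 1 (fun y => cos y - 1) (- sin x).
Proof. by rewrite -[- sin x]subr0; apply: is_deriveB_fun. Qed.

Lemma is_derive_expRB1 x : is_derive x 1 (fun y => expR y - 1) (expR x).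
Proof. by rewrite -[expR x]subr0; apply: is_deriveB_fun. Qed.

Lemma normr_cosB1_le u : `|cos u - 1| <= `|u|.
Proof.
rewrite -[leRHS]mul1r -[`|u|]expr1.
apply: (@derive_bound_growth (fun y => cos y - 1) (fun y => - sin y) `|u|) => //.
- by rewrite cos0 subrr.
- exact: is_derive_cosB1.
- by move=> x _; rewrite expr0 mulr1 normrN ler_norml sin_geN1 sin_le1.
Qed.

Lemma normr_cosB1_le_sqr u : `|cos u - 1| <= `|u| ^+ 2.
Proof.
rewrite -[leRHS]mul1r.
apply: (@derive_bound_growth (fun y => cos y - 1) (fun y => - sin y) `|u|) => //.
- by rewrite cos0 subrr.
- exact: is_derive_cosB1.
- by move=> x _; rewrite mul1r expr1 normrN normr_sin_le.
Qed.

Lemma normr_sinB_le u : `|sin u - u| <= `|u| ^+ 3.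
Proof.
rewrite -[leRHS]mul1r.
apply: (@derive_bound_growth (fun y => sin y - y) (fun y => cos y - 1) `|u|) => //.
- by rewrite sin0 subrr.
- by move=> x _; rewrite mul1r normr_cosB1_le_sqr.
Qed.

Lemma normr_cos_taylor_le u : `|cos u - 1 + u ^+ 2 / 2| <= `|u| ^+ 4.
Proof.
rewrite -[leRHS]mul1r.
apply: (@derive_bound_growth (fun y => cos y - 1 + y ^+ 2 / 2)
  (fun y => - sin y + y) `|u|) => //.
- by rewrite cos0 subrr expr0n mul0r addr0.
- move=> x; have := is_deriveB_fun (is_derive_cosB1 x)
    (is_deriveB_fun (is_derive_cst (0 : R) x 1) (is_derive_half_sqr x)).
  by rewrite sub0r opprK; congr (is_derive _ _ _ _); apply/funext => y;
    rewrite sub0r opprK.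
- by move=> x _; rewrite mul1r addrC -normrN opprB; exact: normr_sinB_le.
Qed.

(** [expR 1] bounds the exponential on [-1, 1] and is carried unchanged to the higher orders. *)
Lemma normr_expRB1_le x : `|x| <= 1 -> `|expR x - 1| <= expR 1 * `|x| ^+ 1.
Proof.
apply: (@derive_bound_growth (fun y => expR y - 1) expR 1).
- by rewrite expR0 subrr.
- exact: is_derive_expRB1.
- move=> y; rewrite ler_norml => /andP[_ y1].
  by rewrite expr0 mulr1 ger0_norm ?expR_ge0// ler_expR.
Qed.

Lemma normr_expRB1B_le x : `|x| <= 1 ->
  `|expR x - 1 - x| <= expR 1 * `|x| ^+ 2.
Proof.
apply: (@derive_bound_growth (fun y => expR y - 1 - y) (fun y => expR y - 1) 1).
- by rewrite expR0 !subrr.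
- move=> y; apply: (@is_deriveB_fun (fun y => expR y - 1) id).
  exact: is_derive_expRB1.
- exact: normr_expRB1_le.
Qed.

Lemma normr_expR_taylor_le x : `|x| <= 1 ->
  `|expR x - 1 - x - x ^+ 2 / 2| <= expR 1 * `|x| ^+ 3.
Proof.
apply: (@derive_bound_growth (fun y => expR y - 1 - y - y ^+ 2 / 2)
  (fun y => expR y - 1 - y) 1).
- by rewrite expR0 subrr expr0n mul0r !subr0.
- move=> y; apply: (@is_deriveB_fun (fun y => expR y - 1 - y)
      (fun y => y ^+ 2 / 2)); last exact: is_derive_half_sqr.
  apply: (@is_deriveB_fun (fun y => expR y - 1) id).
  exact: is_derive_expRB1.
- exact: normr_expRB1B_le.
Qed.

Lemma sinhR_taylor x : `|x| <= 1 -> `|sinhR x - x| <= expR 1 * `|x| ^+ 3.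
Proof.
move=> x1; have h1 := normr_expR_taylor_le x1.
have := @normr_expR_taylor_le (- x); rewrite normrN => /(_ x1) h2.
rewrite sqrrN in h2.
have -> : sinhR x - x = ((expR x - 1 - x - x ^+ 2 / 2) -
   (expR (- x) - 1 - - x - x ^+ 2 / 2)) / 2 by rewrite /sinhR; field.
rewrite normrM [`|2^-1|]gtr0_norm//.
have := ler_normB (expR x - 1 - x - x ^+ 2 / 2) (expR (- x) - 1 - - x - x ^+ 2 / 2).
lra.
Qed.

Lemma coshm1_taylor x : `|x| <= 1 ->
  `|coshm1 x - x ^+ 2 / 2| <= expR 1 * `|x| ^+ 3.
Proof.
move=> x1; have h1 := normr_expR_taylor_le x1.
have := @normr_expR_taylor_le (- x); rewrite normrN => /(_ x1) h2.
rewrite sqrrN in h2.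
have -> : coshm1 x - x ^+ 2 / 2 = ((expR x - 1 - x - x ^+ 2 / 2) +
   (expR (- x) - 1 - - x - x ^+ 2 / 2)) / 2 by rewrite /coshm1; field.
rewrite normrM [`|2^-1|]gtr0_norm//.
have := ler_normD (expR x - 1 - x - x ^+ 2 / 2) (expR (- x) - 1 - - x - x ^+ 2 / 2).
lra.
Qed.

Lemma normc_expi u : normc (expi u) = 1.
Proof. by rewrite /expi /= cos2Dsin2 sqrtr1. Qed.

Lemma expiN u : expi (- u) = (expi u)^-1.
Proof.
rewrite invc_norm normC_normc normc_expi expr1n invr1 mul1r.
by rewrite /expi cosN sinN.
Qed.

Lemma expiB1_le u : normc (expi u - 1) <= 2 * `|u|.
Proof.
rewrite (le_trans (normc_le _))//.
have -> : complex.Re (expi u - 1) = cos u - 1 by [].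
have -> : complex.Im (expi u - 1) = sin u by rewrite /= oppr0 addr0.
have := normr_cosB1_le u; have := normr_sin_le u; lra.
Qed.

(** Away from 0 one has cosh x - 1 >= 1/8, so constants and linear terms are absorbed by its square.
    This makes the expansions near 0 global. *)
Lemma coshm1_large x : 1 < `|x| ->
  1 <= 64 * coshm1 x ^+ 2 /\ coshm1 x <= 8 * coshm1 x ^+ 2.
Proof.
move=> x1; have h := coshm1_ge x.
have x2 : 1 <= x ^+ 2.
  by rewrite -real_normK ?num_real// exprn_ege1// ltW.
have y8 : 1 / 8 <= coshm1 x by lra.
have y2 : coshm1 x <= 8 * coshm1 x ^+ 2.
  rewrite expr2 mulrA -[leLHS]mul1r ler_wpM2r//; lra.
by split=> //; lra.
Qed.

End elementary_expansions.

Ltac nonneg := repeat first [ exact: ler0n | done | exact: sqr_ge0 | exact: normc_ge0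
  | exact: expR_ge0 | exact: ltW | apply: exprn_ge0 | apply: addr_ge0
  | apply: mulr_ge0 ].

(** * Expansion of the rotated increment and its remainder *)

Section remainder.
Variable R : realType.
Variable k : R.
Implicit Types x s : R.

(** The hyperbolic functions agree with x and x^2 / 2 up to O(|x|^3), so for |x| <= 1 this is the
    second order expansion of exp(- i k x). For larger x the terms are bounded separately by
    multiples of (cosh x - 1)^2. *)
Lemma expi_sinh_cosh_expansion : exists2 C, 0 <= C & forall x,
  normc (expi (- (k * x)) - 1 + 0 +i* (k * sinhR x) + (k ^+ 2 * coshm1 x)%:C) <=
  C * (`|x| ^+ 3 + coshm1 x ^+ 2).
Proof.
have k0 := normr_ge0 k; have E0 := expR_ge0 (1 : R).
pose C1 := `|k| ^+ 4 + k ^+ 2 * expR 1 + `|k| ^+ 3 + `|k| * expR 1.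
(* From [coshm1_large]: 128 = 2 * 64 bounds exp(- i k x) - 1, of modulus at most 2, and 72 = 64 + 8
   bounds 1 + (cosh x - 1), which dominates |sinh x|. *)
pose C2 := 128 + 72 * `|k| + 8 * k ^+ 2.
have C10 : 0 <= C1 by nonneg.
have C20 : 0 <= C2 by nonneg.
exists (C1 + C2) => [|x]; first exact: addr_ge0.
have x3 : 0 <= `|x| ^+ 3 by rewrite exprn_ge0.
have y0 := coshm1_ge0 x; have y2 := sqr_ge0 (coshm1 x).
have [x1|x1] := leP `|x| 1.
  suff h : normc (expi (- (k * x)) - 1 + 0 +i* (k * sinhR x) +
      (k ^+ 2 * coshm1 x)%:C) <= C1 * `|x| ^+ 3.
    rewrite (le_trans h)// ler_pM// ?lerDl//.
  rewrite (le_trans (normc_le _))//.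
  set X := _ + _%:C.
  have -> : complex.Re X = (cos (k * x) - 1 + (k * x) ^+ 2 / 2) +
      k ^+ 2 * (coshm1 x - x ^+ 2 / 2).
    by rewrite /X /expi /= cosN exprMn; field.
  have -> : complex.Im X = - (sin (k * x) - k * x) + k * (sinhR x - x).
    by rewrite /X /expi /= sinN; ring.
  have h1 := ler_normD (cos (k * x) - 1 + (k * x) ^+ 2 / 2)
      (k ^+ 2 * (coshm1 x - x ^+ 2 / 2)).
  have h2 := ler_normD (- (sin (k * x) - k * x)) (k * (sinhR x - x)).
  rewrite normrN [`|k * (_ - _)|]normrM in h2.
  rewrite [`|k ^+ 2 * _|]normrM [`|k ^+ 2|]ger0_norm ?sqr_ge0// in h1.
  have h3 := ler_wpM2l k0 (sinhR_taylor x1).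
  have h4 := ler_wpM2l (sqr_ge0 k) (coshm1_taylor x1).
  have := normr_sinB_le (k * x); rewrite normrM exprMn => h5.
  have := normr_cos_taylor_le (k * x); rewrite normrM [X in _ <= X]exprMn => h6.
  have h7 : `|k| ^+ 4 * `|x| ^+ 4 <= `|k| ^+ 4 * `|x| ^+ 3.
    by rewrite ler_wpM2l ?exprn_ge0// exprSr ler_piMr.
  rewrite /C1; lra.
have [h1 h2] := coshm1_large x1.
suff h : normc (expi (- (k * x)) - 1 + 0 +i* (k * sinhR x) +
      (k ^+ 2 * coshm1 x)%:C) <= C2 * coshm1 x ^+ 2.
  by rewrite (le_trans h)// ler_pM// ?lerDr.
rewrite (le_trans (le_normcD _ _))//.
have h3 := le_normcD (expi (- (k * x)) - 1) (0 +i* (k * sinhR x)).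
have h4 := le_normcB (expi (- (k * x))) 1.
rewrite normc_expi normc1 in h4.
have h5 : normc (0 +i* (k * sinhR x)) <= `|k| * (1 + coshm1 x).
  have -> : normc (0 +i* (k * sinhR x)) = `|k * sinhR x|.
    by rewrite /= expr0n add0r sqrtr_sqr.
  by rewrite normrM ler_wpM2l// normr_sinhR_le.
have h6 : normc (k ^+ 2 * coshm1 x)%:C = k ^+ 2 * coshm1 x.
  by rewrite normcC ger0_norm// mulr_ge0// sqr_ge0.
rewrite h6.
have h7 : `|k| * (1 + coshm1 x) <= `|k| * (72 * coshm1 x ^+ 2).
  by rewrite ler_wpM2l//; lra.
have h8 := ler_wpM2l (sqr_ge0 k) h2.
rewrite /C2; lra.
Qed.

Lemma expi_sqr_cosh_expansion : exists2 C, 0 <= C & forall x,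
  normc ((expi (- (k * x)) - 1) ^+ 2 + (2 * k ^+ 2 * coshm1 x)%:C) <=
  C * (`|x| ^+ 3 + coshm1 x ^+ 2).
Proof.
have k0 := normr_ge0 k; have E0 := expR_ge0 (1 : R).
pose C1 := 3 * (`|k| ^+ 3 + `|k| ^+ 4) + 2 * k ^+ 2 * expR 1.
pose C2 := 256 + 16 * k ^+ 2.
have C10 : 0 <= C1.
  by nonneg.
have C20 : 0 <= C2 by nonneg.
exists (C1 + C2) => [|x]; first exact: addr_ge0.
have x3 : 0 <= `|x| ^+ 3 by rewrite exprn_ge0.
have y0 := coshm1_ge0 x; have y2 := sqr_ge0 (coshm1 x).
have [x1|x1] := leP `|x| 1.
  suff h : normc ((expi (- (k * x)) - 1) ^+ 2 + (2 * k ^+ 2 * coshm1 x)%:C) <=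
      C1 * `|x| ^+ 3.
    rewrite (le_trans h)// ler_pM// ?lerDl//.
  pose u := k * x; pose iu : R[i] := 0 +i* u.
  (* With u = k x, the sum (exp(- i u) - 1)^2 + u^2 factors into a term of order |u| and one of
     order u^2, hence is cubic; the last summand corrects u^2 to 2 k^2 (cosh x - 1). *)
  have -> : (expi (- u) - 1) ^+ 2 + (2 * k ^+ 2 * coshm1 x)%:C =
      (expi (- u) - 1 - iu) * (expi (- u) - 1 + iu) +
      (2 * k ^+ 2 * (coshm1 x - x ^+ 2 / 2))%:C.
    have -> : (2 * k ^+ 2 * (coshm1 x - x ^+ 2 / 2))%:C =
        (2 * k ^+ 2 * coshm1 x)%:C + iu ^+ 2.
      rewrite expr2 /iu /u; apply/eqP; rewrite eq_complex /=.
      by apply/andP; split; apply/eqP; field.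
    by ring.
  rewrite (le_trans (le_normcD _ _))// normcM normcC.
  have h1 : normc (expi (- u) - 1 - iu) <= 3 * `|u|.
    have := expiB1_le (- u); rewrite normrN => h.
    have := le_normcB (expi (- u) - 1) iu.
    have -> : normc iu = `|u| by rewrite /= expr0n add0r sqrtr_sqr.
    lra.
  have h2 : normc (expi (- u) - 1 + iu) <= `|u| ^+ 2 + `|u| ^+ 3.
    rewrite (le_trans (normc_le _))//.
    have -> : complex.Re (expi (- u) - 1 + iu) = cos u - 1.
      by rewrite /expi /= cosN addr0.
    have -> : complex.Im (expi (- u) - 1 + iu) = - (sin u - u).
      by rewrite /expi /= sinN; ring.
    by rewrite normrN lerD ?normr_cosB1_le_sqr ?normr_sinB_le.
  have h3 := ler_pM (normc_ge0 _) (normc_ge0 _) h1 h2.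
  have k2 : 0 <= 2 * k ^+ 2 by rewrite mulr_ge0 ?sqr_ge0.
  have := ler_wpM2l k2 (coshm1_taylor x1).
  rewrite -{1}[2 * k ^+ 2]ger0_norm// -normrM => h4.
  have h5 : 3 * `|u| * (`|u| ^+ 2 + `|u| ^+ 3) <= 3 * (`|k| ^+ 3 + `|k| ^+ 4) * `|x| ^+ 3.
    have -> : 3 * `|u| * (`|u| ^+ 2 + `|u| ^+ 3) =
        3 * (`|k| ^+ 3 * `|x| ^+ 3) + 3 * (`|k| ^+ 4 * `|x| ^+ 4).
      by rewrite /u normrM; ring.
    have h7 : `|k| ^+ 4 * `|x| ^+ 4 <= `|k| ^+ 4 * `|x| ^+ 3.
      by rewrite ler_wpM2l ?exprn_ge0// exprSr ler_piMr.
    lra.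
  rewrite /C1; lra.
have [h1 h2] := coshm1_large x1.
suff h : normc ((expi (- (k * x)) - 1) ^+ 2 + (2 * k ^+ 2 * coshm1 x)%:C) <=
    C2 * coshm1 x ^+ 2.
  by rewrite (le_trans h)// ler_pM// ?lerDr.
rewrite (le_trans (le_normcD _ _))// normcX normcC.
have h4 := le_normcB (expi (- (k * x))) 1.
rewrite normc_expi normc1 in h4.
have h5 : normc (expi (- (k * x)) - 1) ^+ 2 <= 2 ^+ 2.
  by rewrite lerXn2r ?nnegrE ?normc_ge0.
rewrite ger0_norm; last by nonneg.
have h8 := ler_wpM2l (sqr_ge0 k) h2.
rewrite /C2; lra.
Qed.

(* The weight s^3 + s y + y^2 / s, with y = cosh x - 1 and s = sqrt t, dominates
   all the error terms and has expectation O(t^(3/2)) at x = B_t. *)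
Lemma error_weight s x : 0 < s -> s <= 1 ->
  let W := s ^+ 3 + s * coshm1 x + coshm1 x ^+ 2 / s in
  [/\ s ^+ 2 * `|x| <= 8 * W, `|x| ^+ 3 <= 64 * W, coshm1 x ^+ 2 <= W &
      s ^+ 3 <= W].
Proof.
move=> s0 s1 W; have y0 := coshm1_ge0 x; have y2 := sqr_ge0 (coshm1 x).
have s3 : 0 <= s ^+ 3 by rewrite exprn_ge0// ltW.
have sy : 0 <= s * coshm1 x by rewrite mulr_ge0// ltW.
have ys : 0 <= coshm1 x ^+ 2 / s by rewrite divr_ge0// ltW.
have hy := coshm1_ge x.
have x2E : `|x| ^+ 2 = x ^+ 2 by rewrite real_normK ?num_real.
have xs : s * `|x| <= s ^+ 2 + x ^+ 2.
  have := sqr_ge0 (s - `|x|); rewrite sqrrB x2E => h.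
  have h2 : 0 <= s * `|x| by rewrite mulr_ge0// ltW.
  have := sqr_ge0 s; have := sqr_ge0 x; move: h; rewrite -mulr_natl; lra.
have hx2 : x ^+ 2 <= 8 * coshm1 x by lra.
split.
- have -> : s ^+ 2 * `|x| = s * (s * `|x|) by ring.
  apply: (@le_trans _ _ (s * (s ^+ 2 + 8 * coshm1 x))).
    by rewrite ler_wpM2l ?(ltW s0)//; lra.
  by rewrite /W mulrDr -exprS; lra.
- have x4 : x ^+ 2 * x ^+ 2 <= 64 * coshm1 x ^+ 2.
    have -> : 64 * coshm1 x ^+ 2 = (8 * coshm1 x) * (8 * coshm1 x) by ring.
    by rewrite ler_pM ?sqr_ge0.
  have : s * `|x| ^+ 3 <= s * (64 * W).
    have -> : s * `|x| ^+ 3 = s * `|x| * x ^+ 2 by rewrite exprS x2E mulrA.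
    apply: (@le_trans _ _ ((s ^+ 2 + x ^+ 2) * x ^+ 2)).
      by rewrite ler_wpM2r ?sqr_ge0.
    apply: (@le_trans _ _ (s ^+ 2 * (8 * coshm1 x) + 64 * coshm1 x ^+ 2)).
      by rewrite mulrDl lerD// ler_wpM2l ?sqr_ge0.
    have -> : s * (64 * W) = 64 * s ^+ 4 + 64 * (s ^+ 2 * coshm1 x) +
        64 * coshm1 x ^+ 2.
      by rewrite /W; field; rewrite gt_eqF.
    have : 0 <= s ^+ 2 * coshm1 x by rewrite mulr_ge0 ?sqr_ge0.
    have : 0 <= s ^+ 4 by rewrite exprn_ge0// ltW.
    lra.
  by rewrite ler_pM2l.
- have : coshm1 x ^+ 2 <= coshm1 x ^+ 2 / s.
    by rewrite ler_pdivlMr// ler_piMr.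
  rewrite /W; lra.
- by rewrite /W; lra.
Qed.

(** To be read with s = sqrt t, x = B_t and xi = phi_t - z. The rotation preserves the modulus of z
    + xi, so the Taylor bound on [f] applies for every x. *)
Lemma remainder_bound (f : R[i] -> R[i]) (z c1 c2 : R[i]) (r M Cg : R) :
  normc z <= 1 -> 0 <= M -> 0 <= Cg ->
  (forall h, normc (z + h) <= r ->
    normc (f (z + h) - f z - c1 * h - c2 * h ^+ 2) <= Cg * normc h ^+ 3) ->
  exists2 C, 0 <= C & forall s x xi, 0 < s -> s <= 1 ->
    normc xi <= M * s ^+ 2 -> normc (z + xi) <= r ->
    normc (f ((z + xi) * expi (- (k * x))) - f z - c1 * xi
      - (- (0 +i* k) * z * c1) * (sinhR x)%:C
      - (- (k ^+ 2)%:C * (z * c1 + 2 * z ^+ 2 * c2)) * (coshm1 x)%:C) <=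
    C * (s ^+ 3 + s * coshm1 x + coshm1 x ^+ 2 / s).
Proof.
move=> z1 M0 Cg0 fh.
have [CA CA0 HA] := expi_sinh_cosh_expansion.
have [CB CB0 HB] := expi_sqr_cosh_expansion.
have n1 := normc_ge0 c1; have n2 := normc_ge0 c2; have k0 := normr_ge0 k.
(* One constant per source of error: D1 the mixed first order term, D2 the replacement of powers of
   x by sinh and cosh (65 = 64 + 1 from the weight), D3 the second order terms containing xi, D4 the
   cubic Taylor error. *)
pose D1 := normc c1 * M * (2 * `|k|) * 8.
pose D2 := (normc c1 * CA + normc c2 * CB) * 65.
pose D3 := normc c2 * (4 * `|k| * M * 8 + M ^+ 2).
pose D4 := Cg * (4 * (64 * (2 * `|k|) ^+ 3 + M ^+ 3)).
have D10 : 0 <= D1 by nonneg.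
have D20 : 0 <= D2 by nonneg.
have D30 : 0 <= D3 by nonneg.
have D40 : 0 <= D4 by nonneg.
exists (D1 + D2 + D3 + D4); first by nonneg.
move=> s x xi s0 s1 xiM zxi.
have [W1 W2 W3 W4] := error_weight x s0 s1.
move: W1 W2 W3 W4; set W := s ^+ 3 + _ + _ => W1 W2 W3 W4.
have W0 : 0 <= W by rewrite (le_trans _ W4)// exprn_ge0// ltW.
set e := expi (- (k * x)); set S := sinhR x; set y := coshm1 x.
pose A := e - 1 + 0 +i* (k * S) + (k ^+ 2 * y)%:C.
pose Q := (e - 1) ^+ 2 + (2 * k ^+ 2 * y)%:C.
(* The full displacement from z. Expanding c1 h + c2 h^2, the parts without xi produce [A] and [Q],
   and c1 xi e splits into c1 xi plus an error. *)
pose h := z * (e - 1) + xi * e.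
pose G := f (z + h) - f z - c1 * h - c2 * h ^+ 2.
have zh : z + h = (z + xi) * e by rewrite /h; ring.
have -> : f ((z + xi) * e) - f z - c1 * xi - - (0 +i* k) * z * c1 * S%:C -
    - (k ^+ 2)%:C * (z * c1 + 2 * z ^+ 2 * c2) * y%:C =
    c1 * xi * (e - 1) + (c1 * z * A + c2 * z ^+ 2 * Q) +
    c2 * (2 * z * (e - 1) * xi * e + xi ^+ 2 * e ^+ 2) + G.
  rewrite /G zh /A /Q.
  have -> : 0 +i* (k * S) = (0 +i* k) * S%:C :> R[i].
    by apply/eqP; rewrite eq_complex /=; apply/andP; split; apply/eqP; ring.
  rewrite !rmorphM /= rmorph_nat /h.
  by ring.
have ne : normc e = 1 by exact: normc_expi.
have e1 : normc (e - 1) <= 2 * `|k| * `|x|.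
  by have := expiB1_le (- (k * x)); rewrite normrN normrM mulrA.
have nx := normr_ge0 x; have nxi := normc_ge0 xi; have ne1 := normc_ge0 (e - 1).
have b1 : normc (c1 * xi * (e - 1)) <= D1 * W.
  rewrite !normcM.
  apply: (@le_trans _ _ (normc c1 * (M * s ^+ 2) * (2 * `|k| * `|x|))).
    by rewrite ler_pM ?mulr_ge0// ler_wpM2l.
  have -> : normc c1 * (M * s ^+ 2) * (2 * `|k| * `|x|) =
      normc c1 * M * (2 * `|k|) * (s ^+ 2 * `|x|) by ring.
  by rewrite /D1 -[leRHS]mulrA; apply: ler_wpM2l => //; rewrite !mulr_ge0.
have x3y : `|x| ^+ 3 + y ^+ 2 <= 65 * W by rewrite /y; lra.
have b2 : normc (c1 * z * A + c2 * z ^+ 2 * Q) <= D2 * W.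
  rewrite (le_trans (le_normcD _ _))//.
  rewrite [normc (c1 * z * A)]normcM [normc (c1 * z)]normcM.
  rewrite [normc (c2 * _ * Q)]normcM [normc (c2 * _)]normcM normcX.
  have hA : normc c1 * normc z * normc A <= normc c1 * (CA * (65 * W)).
    rewrite -mulrA ler_wpM2l// -[leRHS]mul1r ler_pM ?normc_ge0//.
    by rewrite (le_trans (HA x))// ler_wpM2l.
  have hQ : normc c2 * normc z ^+ 2 * normc Q <= normc c2 * (CB * (65 * W)).
    rewrite -mulrA ler_wpM2l// -[leRHS]mul1r ler_pM ?normc_ge0 ?exprn_ge0 ?normc_ge0//.
      by rewrite exprn_ile1 ?normc_ge0.
    by rewrite (le_trans (HB x))// ler_wpM2l.
  rewrite (le_trans (lerD hA hQ))// /D2; lra.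
have s4 : (s ^+ 2) ^+ 2 <= W.
  by rewrite (le_trans _ W4)// -exprM ler_wiXn2l// ltW.
have s6 : (s ^+ 2) ^+ 3 <= W.
  by rewrite (le_trans _ W4)// -exprM ler_wiXn2l// ltW.
have b3 : normc (c2 * (2 * z * (e - 1) * xi * e + xi ^+ 2 * e ^+ 2)) <= D3 * W.
  rewrite normcM /D3 -[leRHS]mulrA ler_wpM2l// (le_trans (le_normcD _ _))//.
  have norm2 : normc 2 = 2 :> R.
    have -> : 2 = (2 : R)%:C :> R[i] by rewrite rmorph_nat.
    by rewrite normcC ger0_norm.
  have -> : normc (2 * z * (e - 1) * xi * e) =
      2 * normc z * normc (e - 1) * normc xi.
    by rewrite normcM ne mulr1 normcM normcM normcM norm2.
  have -> : normc (xi ^+ 2 * e ^+ 2) = normc xi ^+ 2.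
    by rewrite normcM !normcX ne expr1n mulr1.
  have h1 : 2 * normc z * normc (e - 1) * normc xi <=
      4 * `|k| * M * (s ^+ 2 * `|x|).
    apply: (@le_trans _ _ (2 * 1 * (2 * `|k| * `|x|) * (M * s ^+ 2))).
      rewrite ler_pM ?mulr_ge0 ?normc_ge0// ler_pM ?mulr_ge0 ?normc_ge0//.
      by rewrite ler_wpM2l.
    by rewrite le_eqVlt; apply/orP; left; apply/eqP; ring.
  have h2 : normc xi ^+ 2 <= M ^+ 2 * (s ^+ 2) ^+ 2.
    by rewrite -exprMn lerXn2r// nnegrE mulr_ge0 ?sqr_ge0.
  have h3 : 4 * `|k| * M * (s ^+ 2 * `|x|) <= 4 * `|k| * M * (8 * W).
    by rewrite ler_wpM2l ?mulr_ge0.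
  have h4 := ler_wpM2l (sqr_ge0 M) s4.
  rewrite (le_trans (lerD h1 h2))// (le_trans (lerD h3 h4))//.
  by rewrite le_eqVlt; apply/orP; left; apply/eqP; ring.
have b4 : normc G <= D4 * W.
  rewrite (le_trans (fh h _))//; first by rewrite zh normcM ne mulr1.
  rewrite /D4 -[leRHS]mulrA ler_wpM2l//.
  have hh : normc h <= 2 * `|k| * `|x| + M * s ^+ 2.
    rewrite (le_trans (le_normcD _ _))// !normcM ne mulr1 lerD//.
    by rewrite -[leRHS]mul1r ler_pM ?normc_ge0.
  (* Convexity of the cube; it separates the contributions of x and of xi to |h|^3. *)
  have cube (p q : R) : 0 <= p -> 0 <= q -> (p + q) ^+ 3 <= 4 * (p ^+ 3 + q ^+ 3).
    move=> p0 q0; rewrite -subr_ge0.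
    have -> : 4 * (p ^+ 3 + q ^+ 3) - (p + q) ^+ 3 = 3 * (p + q) * (p - q) ^+ 2 by ring.
    by nonneg.
  apply: (@le_trans _ _ ((2 * `|k| * `|x| + M * s ^+ 2) ^+ 3)).
    by rewrite lerXn2r ?nnegrE//; nonneg.
  apply: le_trans (cube _ _ _ _) _; [by nonneg|by nonneg|].
  have -> : (2 * `|k| * `|x|) ^+ 3 = (2 * `|k|) ^+ 3 * `|x| ^+ 3 by rewrite exprMn.
  have -> : (M * s ^+ 2) ^+ 3 = M ^+ 3 * (s ^+ 2) ^+ 3 by rewrite exprMn.
  have q1 : (2 * `|k|) ^+ 3 * `|x| ^+ 3 <= (2 * `|k|) ^+ 3 * (64 * W).
    by apply: ler_wpM2l => //; nonneg.
  have q2 : M ^+ 3 * (s ^+ 2) ^+ 3 <= M ^+ 3 * W.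
    by apply: ler_wpM2l => //; nonneg.
  move: q1 q2; move: ((2 * `|k|) ^+ 3) (`|x| ^+ 3) ((s ^+ 2) ^+ 3) (M ^+ 3).
  by move=> *; lra.
have t1 := le_normcD (c1 * xi * (e - 1) + (c1 * z * A + c2 * z ^+ 2 * Q) +
    c2 * (2 * z * (e - 1) * xi * e + xi ^+ 2 * e ^+ 2)) G.
have t2 := le_normcD (c1 * xi * (e - 1) + (c1 * z * A + c2 * z ^+ 2 * Q))
    (c2 * (2 * z * (e - 1) * xi * e + xi ^+ 2 * e ^+ 2)).
have t3 := le_normcD (c1 * xi * (e - 1)) (c1 * z * A + c2 * z ^+ 2 * Q).
have -> : (D1 + D2 + D3 + D4) * W = D1 * W + D2 * W + D3 * W + D4 * W.
  by rewrite !mulrDl.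
by rewrite (le_trans t1)// lerD// (le_trans t2)// lerD// (le_trans t3)// lerD.
Qed.

End remainder.

(** * The Loewner vector field *)

Section loewner_vector_field.
Variable R : realType.

Lemma cvg_expi (T : Type) (F : set_system T) {FF : Filter F} (g : T -> R) (x : R) :
  g @ F --> x -> (fun t => expi (g t)) @ F --> expi x.
Proof.
move=> gx; apply/cvgC_parts; split.
  by apply: (continuous_cvg _ _ gx); exact: continuous_cos.
by apply: (continuous_cvg _ _ gx); exact: continuous_sin.
Qed.

Definition loewner_field (p : R[i] -> R[i]) (tau u : R[i]) : R[i] :=
  (tau - u) ^+ 2 / tau * p (u / tau).

(** M and L do not depend on tau on the unit circle: this is the source of all uniformity in omega.
    The number 4 bounds |tau - u|^2, and also |2 tau - u - v| in the difference of the two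
    squares. *)
Lemma loewner_field_bounds (a : nat -> R[i]) (p : R[i] -> R[i]) (r : R) :
  (forall z, unit_disk z -> series (fun n => a n * z ^+ n) @ \oo --> p z) ->
  0 < r -> r < 1 ->
  exists M L : R, [/\ 0 <= M, 0 <= L,
    forall tau u, normc tau = 1 -> normc u <= r ->
      normc (loewner_field p tau u) <= M &
    forall tau u v, normc tau = 1 -> normc u <= r -> normc v <= r ->
      normc (loewner_field p tau u - loewner_field p tau v) <=
        L * normc (u - v)].
Proof.
move=> ap r0 r1; have [Lp Lp0 pL] := disk_series_lipschitz ap r0 r1.
pose A := normc (p 0) + Lp * r.
have A0 : 0 <= A by rewrite addr_ge0 ?normc_ge0// mulr_ge0// ltW.
have pA u : normc u <= r -> normc (p u) <= A.
  move=> ur; have h0 : normc (0 : R[i]) <= r by rewrite normc0 ltW.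
  have := pL u 0 ur h0; rewrite subr0 => h.
  rewrite -[p u](subrK (p 0)) (le_trans (le_normcD _ _))// addrC lerD//.
  by rewrite (le_trans h)// ler_wpM2l.
have nd (tau u : R[i]) : normc tau = 1 -> normc (u / tau) = normc u.
  by move=> t1; rewrite normcM normcV t1 invr1 mulr1.
have sq (tau u : R[i]) : normc tau = 1 -> normc u <= r ->
    normc ((tau - u) ^+ 2) <= 4.
  move=> t1 ur; rewrite normcX; have := le_normcB tau u; rewrite t1 => h.
  have -> : 4 = 2 ^+ 2 :> R by rewrite expr2; ring.
  by rewrite lerXn2r ?nnegrE ?normc_ge0//; lra.
exists (4 * A), (4 * A + 4 * Lp); split.
- by rewrite mulr_ge0.
- by rewrite addr_ge0 ?mulr_ge0.
- move=> tau u t1 ur; rewrite /loewner_field normcM nd//.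
  by rewrite ler_pM ?normc_ge0 ?sq// pA// nd.
- move=> tau u v t1 ur vr.
  have -> : loewner_field p tau u - loewner_field p tau v =
      (v - u) * (2 * tau - u - v) / tau * p (u / tau) +
      (tau - v) ^+ 2 / tau * (p (u / tau) - p (v / tau)).
    by rewrite /loewner_field; ring.
  rewrite (le_trans (le_normcD _ _))// [leRHS]mulrDl lerD//.
    rewrite normcM nd// normcM (normcB v) [leRHS]mulrC -mulrA.
    rewrite ler_wpM2l ?normc_ge0// ler_pM ?normc_ge0//; last by rewrite pA// nd.
    have -> : 2 * tau - u - v = (tau - u) + (tau - v) by ring.
    have := le_normcD (tau - u) (tau - v).
    have := le_normcB tau u; have := le_normcB tau v; rewrite t1; lra.
  rewrite normcM nd// -[leRHS]mulrA ler_pM ?normc_ge0 ?sq//.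
  have := pL (u / tau) (v / tau); rewrite !nd// => /(_ ur vr).
  by rewrite -mulrBl nd.
Qed.

(** Divisions become products, so that continuity and measurability follow from the rules for
    products and for [expi]. *)
Lemma loewner_field_expi (p : R[i] -> R[i]) (x : R) (u : R[i]) :
  loewner_field p (expi x) u =
  (expi x - u) * (expi x - u) * expi (- x) * p (u * expi (- x)).
Proof. by rewrite /loewner_field expiN expr2. Qed.

Lemma normc_mul_expi (u : R[i]) (x : R) : normc (u * expi x) = normc u.
Proof. by rewrite normcM normc_expi mulr1. Qed.

End loewner_vector_field.

(** * Short-time behaviour and measurability of the flow *)

Section flow.
Context (R : realType) (d : measure_display) (Omega : measurableType d)
  (P : probability Omega R) (F : R -> set (set Omega)) (B : R -> Omega -> R)
  (k : R) (p : R[i] -> R[i]) (a : nat -> R[i]) (phi : R -> R[i] -> Omega -> R[i]).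
Hypotheses (FF : filtration F) (BM : brownian_motion P F B)
  (ph : holomorphic_on unit_disk p)
  (ap : forall z, unit_disk z -> series (fun n => a n * z ^+ n) @ \oo --> p z)
  (flow : loewner_flow p (boundary_point k B) phi).

Let V w t u := loewner_field p (expi (k * B t w)) u.

Let p_continuous u : normc u < 1 -> {for u, continuous p}.
Proof.
rewrite -unit_diskE => /ph /derivableCP; exact: cderiv_continuous.
Qed.

Lemma brownian_path_cvg w (T s : R) : 0 <= s <= T ->
  B s' w @[s' --> within [set x : R | 0 <= x <= T] (nbhs s)] --> B s w.
Proof.
move=> /andP[s0 sT].
have : {within `[0, +oo[, continuous (fun t => B t w)}.
  exact: (bm_continuous BM).
move=> /subspace_continuousP /(_ s).
rewrite /= in_itv /= s0 => /(_ isT) H.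
apply: cvg_trans H; apply: cvg_fmap2; apply: within_subset => x /andP[x0 _].
by rewrite /= in_itv /= x0.
Qed.

(** Supplies the consistency hypothesis of [euler_cvg]: phi is differentiable in time, hence
    continuous, the path is continuous, and the argument of [p] stays in the disk. *)
Lemma loewner_speed_continuous w z (T : R) : unit_disk z ->
  forall s, 0 <= s <= T -> forall e, 0 < e -> exists2 h, 0 < h &
     forall s', 0 <= s' <= T -> `|s' - s| < h ->
       normc (V w s' (phi s' z w) - V w s (phi s z w)) < e.
Proof.
move=> zD s sT; have [_ fl] := flow w zD.
have s0 : 0 <= s by case/andP: sT.
pose G := within [set x : R | 0 <= x <= T] (nbhs s).
have FG : Filter G by exact: within_filter.
have Bc : B s' w @[s' --> G] --> B s w by exact: brownian_path_cvg.
have kBc : k * B s' w @[s' --> G] --> k * B s w by exact: cvgMr.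
have tc : expi (k * B s' w) @[s' --> G] --> expi (k * B s w) by exact: cvg_expi.
have tNc : expi (- (k * B s' w)) @[s' --> G] --> expi (- (k * B s w)).
  by apply: cvg_expi; exact: cvgN.
have gc : phi s' z w @[s' --> G] --> phi s z w.
  apply: (@cvgC_normc _ _ G) => e e0.
  have [h h0 H] := has_time_derivative_continuous (proj2 (fl s s0)) e0.
  rewrite near_withinE; apply/nbhs_ballP; exists h => // s'.
  rewrite -ball_normE /= distrC => hs /andP[s'0 _].
  by rewrite normcB; exact: H.
have Vc : V w s' (phi s' z w) @[s' --> G] --> V w s (phi s z w).
  rewrite /V; under eq_fun do rewrite loewner_field_expi.
  rewrite loewner_field_expi.
  have uc : (fun s' => phi s' z w * expi (- (k * B s' w))) @ G -->
      phi s z w * expi (- (k * B s w)) by exact: (cvgM gc tNc).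
  have un : normc (phi s z w * expi (- (k * B s w))) < 1.
    by rewrite normc_mul_expi -unit_diskE; case: (fl s s0).
  have pc : p (phi s' z w * expi (- (k * B s' w))) @[s' --> G] -->
      p (phi s z w * expi (- (k * B s w))).
    exact: (cvg_comp _ _ uc (p_continuous un)).
  have sc : expi (k * B s' w) - phi s' z w @[s' --> G] -->
      expi (k * B s w) - phi s z w by exact: (cvgB tc gc).
  by apply: (cvgM _ pc); apply: (cvgM _ tNc); exact: (cvgM sc sc).
move=> e e0.
have /nbhs_ballP[h /= h0 H] : nbhs s (fun s' => 0 <= s' <= T ->
    normc (V w s (phi s z w) - V w s' (phi s' z w)) < e).
  exact: (proj1 (cvgCP _ _) Vc e e0).
exists h => // s' s'T ss'; rewrite normcB; apply: H => //.
by rewrite -ball_normE /= distrC.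
Qed.

Lemma loewner_flow_short_time z : unit_disk z ->
  exists r T M : R, [/\ normc z < r, r < 1, 0 < T, 0 <= M &
    forall t, 0 <= t <= T ->
      [/\ forall w, normc (phi t z w - z) <= M * t,
          forall w, normc (phi t z w) <= r &
          cmeasurable (phi t z)]].
Proof.
move=> zD; have z1 : normc z < 1 by rewrite -unit_diskE.
have z0 := normc_ge0 z.
pose r := (1 + normc z) / 2.
have zr : normc z < r by rewrite /r; lra.
have r1 : r < 1 by rewrite /r; lra.
have r0 : 0 < r by rewrite /r; lra.
have [M [L [M0 L0 VM VL]]] := loewner_field_bounds ap r0 r1.
(* Short enough that at speed M the disk of radius r cannot be left. Here r is midway between |z|
   and 1, M + 1 covers M = 0, and no choice involves the path. *)
pose T := (r - normc z) / (M + 1).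
have M1 : 0 < M + 1 by lra.
have T0 : 0 < T by rewrite divr_gt0// subr_gt0.
have MT : M * T < r - normc z.
  by rewrite /T mulrA ltr_pdivrMr// mulrC ltr_pM2l ?subr_gt0// ltrDl.
clearbody r T.
have VM' w t u : normc u <= r -> normc (V w t u) <= M.
  by apply: VM; exact: normc_expi.
have dphi w t : 0 <= t -> has_time_derivative (fun s => phi s z w) t
    (V w t (phi t z w)).
  by move=> t0; case: (flow w zD) => _ /(_ t t0) [].
have phi0 w : phi 0 z w = z by case: (flow w zD).
have close w t : 0 <= t <= T -> normc (phi t z w - z) <= M * t.
  rewrite -{2}(phi0 w); move: t.
  apply: (@curve_stays_close _ (fun s => phi s z w) (fun s => V w s (phi s z w))
    T M (r - normc z)) => // [s /andP[s0 _]|s _]; first exact: dphi.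
  rewrite phi0 => h; apply: VM'.
  rewrite -[phi s z w](subrK z) (le_trans (le_normcD _ _))//; lra.
have inr w t : 0 <= t <= T -> normc (phi t z w) <= r.
  move=> tT; rewrite -[phi t z w](subrK z) (le_trans (le_normcD _ _))//.
  have := close w t tT; have : M * t <= M * T.
    by rewrite ler_wpM2l//; case/andP: tT.
  lra.
exists r, T, M; split=> // t tT; split=> [w|w|]; [exact: close|exact: inr|].
have /andP[t0 tT'] := tT.
have zMt : normc z + M * t <= r.
  have : M * t <= M * T by rewrite ler_wpM2l.
  lra.
(* An Euler iterate depends on the path only through finitely many values B_(j h), and is therefore
   measurable. *)
apply: (@cmeasurable_cvg _ _ _ (fun n w => euler (V w) (t / n.+1%:R) z n.+1)).
  move=> n; set h := t / n.+1%:R.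
  have h0 : 0 <= h by rewrite divr_ge0.
  have nh : n.+1%:R * h = t by rewrite mulrC divfK// pnatr_eq0.
  suff H j : (j <= n.+1)%N -> cmeasurable (fun w => euler (V w) h z j).
    exact: H.
  elim: j => [|j IH] jn /=; first exact: cmeasurable_cst.
  have {}IH := IH (ltnW jn).
  have jh : 0 <= j%:R * h by rewrite mulr_ge0.
  have mkB : measurable_fun setT (fun w => k * B (j%:R * h) w).
    by apply: measurable_funM => //; exact: (brownian_measurable FF BM jh).
  have mNkB : measurable_fun setT (fun w => - (k * B (j%:R * h) w)).
    exact: measurableT_comp.
  have m1 := cmeasurable_expi mkB; have m2 := cmeasurable_expi mNkB.
  apply: cmeasurableD => //; apply: cmeasurableM; first exact: cmeasurable_cst.
  rewrite /V; under eq_fun do rewrite loewner_field_expi.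
  have mN : cmeasurable (fun w => expi (k * B (j%:R * h) w) - euler (V w) h z j).
    apply: cmeasurableD => //.
    under eq_fun do rewrite -mulN1r.
    by apply: cmeasurableM => //; exact: cmeasurable_cst.
  apply: cmeasurableM.
    by apply: cmeasurableM => //; exact: cmeasurableM.
  apply: cmeasurable_comp; first exact: cmeasurableM.
  move=> w; apply: p_continuous; rewrite normc_mul_expi.
  have VMw s u : 0 <= s <= t -> normc u <= r -> normc (V w s u) <= M.
    by move=> _; exact: VM'.
  have /andP[e1 e2] := euler_bounded M0 VMw zMt h0 nh (ltnW jn).
  exact: le_lt_trans (le_trans e1 e2) r1.
move=> w.
apply: (@euler_cvg _ (V w) z t r M L t0 M0 L0 _ _ zMt (fun s => phi s z w)).
- by move=> s u _; exact: VM'.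
- by move=> s u v _; apply: VL; exact: normc_expi.
- exact: phi0.
- by move=> s /andP[s0 _]; exact: dphi.
- by move=> s /andP[s0 st]; apply: inr; rewrite s0 (le_trans st).
- exact: loewner_speed_continuous.
Qed.

End flow.

(** * Complex expectations and a limit under the integral *)

Section complex_expectation.
Context (R : realType) (d : measure_display) (Omega : measurableType d)
  (P : probability Omega R).
Implicit Types (X Y : Omega -> R[i]) (f g : Omega -> R).

Lemma cexpectationE X : cexpectation P X =
  (\int[P]_w complex.Re (X w)) +i* (\int[P]_w complex.Im (X w)).
Proof. by rewrite /cexpectation !unlock. Qed.

Lemma integrable_of_bounded f (K : R) : measurable_fun setT f ->
  (forall w, `|f w| <= K) -> P.-integrable setT (EFin \o f).
Proof.
move=> mf fK; apply: (@le_integrable _ _ _ _ _ measurableT _ (EFin \o (fun=> K))).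
- exact/measurable_EFinP.
- by move=> w _; rewrite /= lee_fin (le_trans (fK w))// ler_norm.
- exact: integrable_cst_prob.
Qed.

Lemma cintegrable_of_bounded X (K : R) : cmeasurable X ->
  (forall w, normc (X w) <= K) -> cintegrable P X.
Proof.
move=> [X1 X2] XK; split.
  by apply: (integrable_of_bounded X1) => w; exact: le_trans (normRe_le _) (XK w).
by apply: (integrable_of_bounded X2) => w; exact: le_trans (normIm_le _) (XK w).
Qed.

Lemma cintegrable_cst (c : R[i]) : cintegrable P (cst c).
Proof. by split; exact: integrable_cst_prob. Qed.

Lemma cintegrableD X Y : cintegrable P X -> cintegrable P Y ->
  cintegrable P (fun w => X w + Y w).
Proof.
move=> [X1 X2] [Y1 Y2]; split.
  rewrite [X in P.-integrable _ X](_ : _ =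
    EFin \o (fun w => complex.Re (X w) + complex.Re (Y w))); first exact: integrableD_fun.
  by apply/funext => w; rewrite raddfD.
rewrite [X in P.-integrable _ X](_ : _ =
    EFin \o (fun w => complex.Im (X w) + complex.Im (Y w))); first exact: integrableD_fun.
by apply/funext => w; rewrite raddfD.
Qed.

Lemma cexpectationD X Y : cintegrable P X -> cintegrable P Y ->
  cexpectation P (fun w => X w + Y w) = cexpectation P X + cexpectation P Y.
Proof.
move=> [X1 X2] [Y1 Y2]; rewrite !cexpectationE.
under eq_Rintegral do rewrite raddfD.
rewrite RintegralD//; under [X in _ +i* X]eq_Rintegral do rewrite raddfD.
by rewrite RintegralD.
Qed.

Let ReM (c : R[i]) X : (fun w => complex.Re (c * X w)) = (fun w =>
  complex.Re c * complex.Re (X w) + - complex.Im c * complex.Im (X w)).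
Proof.
by apply/funext => w; case: c (X w) => ? ? [? ?] /=; rewrite mulNr.
Qed.

Let ImM (c : R[i]) X : (fun w => complex.Im (c * X w)) = (fun w =>
  complex.Re c * complex.Im (X w) + complex.Im c * complex.Re (X w)).
Proof. by apply/funext => w; case: c (X w) => ? ? [? ?]. Qed.

Lemma cintegrableZ (c : R[i]) X : cintegrable P X ->
  cintegrable P (fun w => c * X w).
Proof.
move=> [X1 X2]; split.
  change (P.-integrable setT (EFin \o (fun w => complex.Re (c * X w)))).
  by rewrite ReM; apply: integrableD_fun; exact: integrableZ_fun.
change (P.-integrable setT (EFin \o (fun w => complex.Im (c * X w)))).
by rewrite ImM; apply: integrableD_fun; exact: integrableZ_fun.
Qed.

Lemma cexpectationZ (c : R[i]) X : cintegrable P X ->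
  cexpectation P (fun w => c * X w) = c * cexpectation P X.
Proof.
move=> [X1 X2]; rewrite !cexpectationE ReM ImM.
rewrite !RintegralD//; try exact: integrableZ_fun.
rewrite !RintegralZl//.
by case: c => x y; apply/eqP; rewrite eq_complex /=; apply/andP; split;
  apply/eqP; ring.
Qed.

Lemma cexpectation_cst (c : R[i]) : cexpectation P (cst c) = c.
Proof. by rewrite cexpectationE !Rintegral_cst_prob; case: c. Qed.

Lemma cintegrable_real f : P.-integrable setT (EFin \o f) ->
  cintegrable P (fun w => (f w)%:C).
Proof. by move=> fi; split => //; exact: integrable_cst_prob. Qed.

Lemma cexpectation_real f :
  cexpectation P (fun w => (f w)%:C) = (\int[P]_w f w)%:C.
Proof. by rewrite cexpectationE /= Rintegral_cst_prob. Qed.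

(** The factor 2 comes from bounding real and imaginary parts separately. *)
Lemma normc_cexpectation_le X g : cintegrable P X ->
  P.-integrable setT (EFin \o g) -> (forall w, normc (X w) <= g w) ->
  normc (cexpectation P X) <= 2 * \int[P]_w g w.
Proof.
move=> [X1 X2] gi Xg; rewrite cexpectationE (le_trans (normc_le _))//=.
have H f : P.-integrable setT (EFin \o f) -> (forall w, `|f w| <= g w) ->
    `|\int[P]_w f w| <= \int[P]_w g w.
  move=> fi fg; rewrite (le_trans (le_normr_Rintegral _ fi))//.
  by apply: le_Rintegral => //; exact: (integrable_norm fi).
have h1 := H _ X1 (fun w => le_trans (normRe_le _) (Xg w)).
have h2 := H _ X2 (fun w => le_trans (normIm_le _) (Xg w)).
lra.
Qed.

Lemma Rintegral_div_cvg (Y : R -> Omega -> R) (T M v : R) : 0 < T ->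
  (forall t, 0 < t -> t <= T -> measurable_fun setT (Y t)) ->
  (forall t w, 0 < t -> t <= T -> `|Y t w| <= M * t) ->
  (forall w, Y t w / t @[t --> 0^'+] --> v) ->
  (\int[P]_w Y t w) / t @[t --> 0^'+] --> v.
Proof.
move=> T0 mY YM Yv; apply/cvg_at_rightP => u [u0 ucv].
(* Dominated convergence runs along a sequence of times. Beyond T neither measurability nor the
   bound is known; the value 0 there affects finitely many indices. *)
pose g n w := if u n <= T then Y (u n) w / u n else 0.
have M0 : 0 <= M.
  have := YM T point T0 (lexx _); move=> /(le_trans (normr_ge0 _)).
  by rewrite pmulr_lge0.
have uT : \forall n \near \oo, u n <= T.
  have [N _ H] := proj1 (cvgrPdist_lt _ _) ucv T T0; exists N => // n /H /=.
  by rewrite sub0r normrN => /(le_lt_trans (ler_norm _))/ltW.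
have gM n w : `|g n w| <= M.
  rewrite /g; case: ifPn => [unT|_]; last by rewrite normr0.
  by rewrite normrM normfV [`|u n|]gtr0_norm// ler_pdivrMr// YM.
have mg n : measurable_fun setT (g n).
  rewrite /g; case: (u n <= T) (mY (u n) (u0 n)) => [mYn|_]; last exact: measurable_cst.
  by apply: measurable_funM; [exact: mYn|exact: measurable_cst].
have gv w : g ^~ w @ \oo --> v.
  have H := proj1 (cvg_at_rightP _ _ _) (Yv w) u (conj u0 ucv).
  apply: cvg_trans H; apply: near_eq_cvg.
  case: uT => N _ uT; exists N => // n /uT unT.
  by rewrite /= /g unT.
have H : (\int[P]_x (g n x)%:E)%E @[n --> \oo] --> (\int[P]_x v%:E)%E.
  apply: (@dominated_cvg _ _ _ P setT measurableT (fun n => EFin \o g n)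
    (EFin \o (fun=> v)) (EFin \o (fun=> M))) => //.
  - by move=> n; exact/measurable_EFinP.
  - by move=> w _; apply/fine_cvgP; split; [exact: nearW|exact: gv].
  - exact: integrable_cst_prob.
  - by move=> n w _ /=; rewrite lee_fin gM.
have Ev : (\int[P]_x v%:E)%E = v%:E.
  rewrite integral_cst//; transitivity (v%:E * 1)%E; last exact: mule1.
  by congr (_ * _)%E; exact: probability_setT.
rewrite Ev in H; have [_ {}H] := proj1 (fine_cvgP _ _) H.
apply: cvg_trans H; apply: near_eq_cvg.
case: uT => N _ uT; exists N => // n /uT unT.
have Yi : P.-integrable setT (EFin \o Y (u n)).
  by apply: (integrable_of_bounded (K := M * u n)); [exact: mY|move=> w; exact: YM].
rewrite /= -[fine _]/(\int[P]_w g n w) /g unT.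
by rewrite RintegralZr.
Qed.

End complex_expectation.

(** * The series in the L_n and the generator of Psi *)

Section generator.
Context (R : realType).

Lemma cderiv_mul_id (g : R[i] -> R[i]) (z l : R[i]) : cderiv g z l ->
  cderiv (fun w => - w * g w) z (- (g z) - z * l).
Proof.
move=> gl e e0; have z0 := normc_ge0 z; have l0 := normc_ge0 l.
have q0 : 0 < 1 + normc z by rewrite ltr_pwDl.
have e2 : 0 < e / 2 / (1 + normc z) by rewrite !divr_gt0.
have [d d0 H] := gl _ e2.
have l1 : 0 < 1 + normc l by rewrite ltr_pwDl.
exists (Num.min (Num.min d 1) (e / 2 / (1 + normc l))).
  by rewrite !lt_min d0 ltr01 !divr_gt0.
move=> h; rewrite !lt_min => /andP[/andP[hd h1]]; rewrite ltr_pdivlMr// => he.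
have -> : - (z + h) * g (z + h) - - z * g z - (- g z - z * l) * h =
   - ((z + h) * (g (z + h) - g z - l * h)) - h * h * l by ring.
rewrite (le_trans (le_normcB _ _))// normcN !normcM.
have h0 := normc_ge0 h.
have a1 : normc (z + h) * normc (g (z + h) - g z - l * h) <= e / 2 * normc h.
  apply: (@le_trans _ _ ((1 + normc z) * (e / 2 / (1 + normc z) * normc h))).
    rewrite ler_pM ?normc_ge0//; last exact: H.
    by rewrite (le_trans (le_normcD _ _))// addrC lerD2r ltW.
  by rewrite le_eqVlt; apply/orP; left; apply/eqP; field; rewrite gt_eqF.
have a2 : normc h * normc h * normc l <= e / 2 * normc h.
  rewrite mulrAC ler_wpM2r// (le_trans _ (ltW he))// ler_wpM2l//; lra.
rewrite [leRHS](_ : _ = e / 2 * normc h + e / 2 * normc h); last by field.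
exact: lerD.
Qed.

(** Besides the second order term, L_0^2 yields the drift z f'(z); both terms of A carrying k^2 thus
    come from it. *)
Lemma L_op0_sqr (f : R[i] -> R[i]) (z : R[i]) :
  cderiv (derive1 f) z (derive1n 2 f z) ->
  L_op 0 (L_op 0 f) z = z * derive1 f z + z ^+ 2 * derive1n 2 f z.
Proof.
move=> /cderiv_mul_id /cderiv_derive1 E.
have -> : L_op 0 f = (fun w => - w * derive1 f w).
  by apply/funext => w; rewrite /L_op add0r expr1z.
by rewrite /L_op add0r expr1z E; ring.
Qed.

(** Taking second differences is convolution with the coefficients of (1 - z)^2, hence three shifted
    partial sums of the series of [p]. Starting at n + 2 makes all shifts meaningful and leaves the
    negative indices to the base case. *)
Lemma L_seriesE (a : nat -> R[i]) (f : R[i] -> R[i]) (z : R[i]) (n : nat) :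
  let S := series (fun m => a m * z ^+ m) in
  L_series a f z n.+2 = - (S n.+2 - 2 * z * S n.+1 + z ^+ 2 * S n) * derive1 f z.
Proof.
move=> S; have SS m : S m.+1 = S m + a m * z ^+ m by rewrite /S /series /= big_nat_recr.
have S0 : S 0 = 0 by rewrite /S /series /= big_geq.
have sd (m : nat) : L_op (m%:Z - 1) f z = - z ^+ m * derive1 f z.
  by rewrite /L_op subrK.
have LS m : L_series a f z m.+1 =
    L_series a f z m + second_diff a (m%:Z - 1) * L_op (m%:Z - 1) f z.
  by rewrite /L_series /series /= big_nat_recr.
have sd0 : second_diff a (0%:Z - 1) = a 0%N.
  rewrite /second_diff subrK (_ : 0%:Z - 1 = Negz 0)// (_ : Negz 0 - 1 = Negz 1)//.
  by rewrite /coefz; ring.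
have sd1 : second_diff a (1%:Z - 1) = a 1%N - 2 * a 0%N.
  by rewrite /second_diff subrK (_ : 1%:Z - 1 = Posz 0)// /coefz; ring.
elim: n => [|n IH].
  rewrite !LS !sd sd0 sd1 !SS S0.
  have -> : L_series a f z 0 = 0 by rewrite /L_series /series /= big_geq.
  by rewrite !expr0 !expr1; ring.
rewrite LS IH sd !SS.
have -> : second_diff a (n.+2%:Z - 1) = a n.+2 - 2 * a n.+1 + a n.
  rewrite /second_diff subrK.
  have -> : n.+2%:Z - 1 = n.+1 by rewrite -[n.+2]addn1 PoszD addrK.
  by have -> : n.+1%:Z - 1 = n by rewrite -[n.+1]addn1 PoszD addrK.
by rewrite !exprS; ring.
Qed.

Lemma cvg_cstMl (T : Type) (G : set_system T) {GF : Filter G} (c : R[i])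
    (u : T -> R[i]) (l : R[i]) : u @ G --> l -> (fun n => c * u n) @ G --> c * l.
Proof.
move=> ul; have cc : (fun=> c) @ G --> c by exact: cvg_cst.
exact: (cvgM cc ul).
Qed.

Lemma L_series_cvg (a : nat -> R[i]) (p f : R[i] -> R[i]) (z : R[i]) :
  series (fun n => a n * z ^+ n) @ \oo --> p z ->
  L_series a f z @ \oo --> - ((z - 1) ^+ 2 * p z) * derive1 f z.
Proof.
move=> pz; pose S := series (fun n => a n * z ^+ n).
rewrite -(cvg_shiftn 2).
have S1 : (fun n => S n.+1) @ \oo --> p z by rewrite (cvg_shiftS S).
have S2 : (fun n => S n.+2) @ \oo --> p z by rewrite (cvg_shiftS (fun n => S n.+1)).
have -> : - ((z - 1) ^+ 2 * p z) * derive1 f z =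
    derive1 f z * - (p z - 2 * z * p z + z ^+ 2 * p z) by ring.
have -> : (fun n => L_series a f z (n + 2)) =
    (fun n => derive1 f z * - (S n.+2 - 2 * z * S n.+1 + z ^+ 2 * S n)).
  by apply/funext => n; rewrite addn2 L_seriesE mulrC.
have c1 : (fun n => 2 * z * S n.+1) @ \oo --> 2 * z * p z.
  exact: (cvg_cstMl (c := 2 * z) S1).
have c2 : (fun n => z ^+ 2 * S n) @ \oo --> z ^+ 2 * p z.
  exact: (cvg_cstMl (c := z ^+ 2) pz).
have c3 : (fun n => S n.+2 - 2 * z * S n.+1 + z ^+ 2 * S n) @ \oo -->
    p z - 2 * z * p z + z ^+ 2 * p z.
  by apply: (cvgD (cvgB S2 c1) c2).
exact: (cvg_cstMl (c := derive1 f z) (cvgN c3)).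
Qed.

Lemma Re_divC (x : R[i]) (t : R) : complex.Re (x / t%:C) = complex.Re x / t.
Proof. by rewrite -fmorphV; case: x => a b /=; rewrite mulr0 subr0. Qed.

Lemma Im_divC (x : R[i]) (t : R) : complex.Im (x / t%:C) = complex.Im x / t.
Proof. by rewrite -fmorphV; case: x => a b /=; rewrite mulr0 add0r. Qed.

(** Extends the local Taylor bound to the whole disk: for |h| > d the left side is at most the
    constant [N], since |h| <= 2, and |h|^3 exceeds d^3. *)
Lemma cubic_bound_on_disk (f : R[i] -> R[i]) (z c1 c2 : R[i]) (r C d K : R) :
  0 < d -> 0 <= C -> 0 <= K -> normc z <= r -> r <= 1 ->
  (forall w, normc w <= r -> normc (f w) <= K) ->
  (forall h, normc h <= d ->
    normc (f (z + h) - f z - c1 * h - c2 * h ^+ 2) <= C * normc h ^+ 3) ->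
  exists2 C', 0 <= C' & forall h, normc (z + h) <= r ->
    normc (f (z + h) - f z - c1 * h - c2 * h ^+ 2) <= C' * normc h ^+ 3.
Proof.
move=> d0 C0 K0 zr r1 fK fd.
have n1 := normc_ge0 c1; have n2 := normc_ge0 c2.
pose N := K + K + normc c1 * 2 + normc c2 * 4.
have N0 : 0 <= N by nonneg.
have d3 : 0 < d ^+ 3 by rewrite exprn_gt0.
have Nd : 0 <= N / d ^+ 3 by rewrite divr_ge0// ltW.
exists (C + N / d ^+ 3) => [|h zh]; first exact: addr_ge0.
have h0 := normc_ge0 h; have h3 : 0 <= normc h ^+ 3 by rewrite exprn_ge0.
have [hd|hd] := leP (normc h) d.
  by rewrite (le_trans (fd h hd))// ler_wpM2r// lerDl.
have h2 : normc h <= 2.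
  have := le_normcB (z + h) z; rewrite addrAC subrr add0r; lra.
apply: (@le_trans _ _ N).
  rewrite (le_trans (le_normcB _ _))// lerD//; last first.
    rewrite normcM ler_wpM2l// normcX; have -> : 4 = 2 ^+ 2 :> R by ring.
    by rewrite lerXn2r ?nnegrE.
  rewrite (le_trans (le_normcB _ _))// lerD//; last by rewrite normcM ler_wpM2l.
  by rewrite (le_trans (le_normcB _ _))// lerD// fK.
apply: (@le_trans _ _ (N / d ^+ 3 * normc h ^+ 3)).
  rewrite mulrAC ler_pdivlMr// ler_wpM2l// lerXn2r// ?nnegrE// ltW//.
by rewrite ler_wpM2r// lerDr.
Qed.

Lemma near_right0 (T : R) : 0 < T -> \forall t \near 0^'+, 0 < t <= T.
Proof.
move=> T0; near=> t; apply/andP; split; near: t; first exact: nbhs_right_gt.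
exact: nbhs_right_le.
Unshelve. all: by end_near. Qed.

Context (d : measure_display) (Omega : measurableType d)
  (P : probability Omega R) (F : R -> set (set Omega)) (B : R -> Omega -> R)
  (k : R) (p : R[i] -> R[i]) (a : nat -> R[i]) (phi : R -> R[i] -> Omega -> R[i]).
Hypotheses (FF : filtration F) (BM : brownian_motion P F B).

(** With t = s^2, the three summands have means at most s^3, s * s^2 and 4 s^4 / s, whence 6 = 1 + 1
    + 4. *)
Lemma error_weight_mean_le (s : R) : 0 < s -> s ^+ 2 <= 1 / 4 ->
  let W w := s ^+ 3 + s * coshm1 (B (s ^+ 2) w) + coshm1 (B (s ^+ 2) w) ^+ 2 / s in
  P.-integrable setT (EFin \o W) /\ \int[P]_w W w <= 6 * s ^+ 3.
Proof.
move=> s0 s4 W; have t0 : 0 < s ^+ 2 by rewrite exprn_gt0.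
have WE : W = (fun w => (s ^+ 3 + s * coshm1 (B (s ^+ 2) w)) +
    s^-1 * coshm1 (B (s ^+ 2) w) ^+ 2).
  by apply/funext => w; rewrite /W [s^-1 * _]mulrC.
have i1 := integrableZ_fun s (brownian_coshm1_integrable FF BM t0).
have i2 := integrableZ_fun s^-1 (brownian_coshm1_sqr_integrable FF BM t0).
have i0 := integrable_cst_prob P (s ^+ 3).
have i01 := integrableD_fun i0 i1.
split; first by rewrite WE; exact: (integrableD_fun i01 i2).
rewrite WE RintegralD// RintegralD// Rintegral_cst_prob.
rewrite RintegralZl//; last exact: (brownian_coshm1_integrable FF BM t0).
rewrite RintegralZl//; last exact: (brownian_coshm1_sqr_integrable FF BM t0).
rewrite (brownian_coshm1_mean FF BM t0).
have h1 := brownian_coshm1_sqr_mean_le FF BM t0 s4.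
have h2 : expR (s ^+ 2 / 2) - 1 <= s ^+ 2.
  have := @expR_le_quadratic R (s ^+ 2 / 2).
  rewrite [(s ^+ 2 / 2) ^+ 2](_ : _ = s ^+ 2 * s ^+ 2 / 4); last by field.
  have : s ^+ 2 * s ^+ 2 <= s ^+ 2 * 1 by rewrite ler_wpM2l ?(ltW t0)//; lra.
  lra.
have h3 : s * (expR (s ^+ 2 / 2) - 1) <= s ^+ 3.
  by rewrite exprS ler_wpM2l// ltW.
have h4 : s^-1 * \int[P]_w coshm1 (B (s ^+ 2) w) ^+ 2 <= 4 * s ^+ 3.
  rewrite mulrC ler_pdivrMr// (le_trans h1)// le_eqVlt; apply/orP; left.
  by apply/eqP; ring.
lra.
Qed.

Hypotheses (ph : holomorphic_on unit_disk p)
  (ap : forall z, unit_disk z -> series (fun n => a n * z ^+ n) @ \oo --> p z)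
  (flow : loewner_flow p (boundary_point k B) phi).

Lemma loewner_initial_speed z w : unit_disk z ->
  (phi t z w - z) / t%:C @[t --> 0^'+] --> (z - 1) ^+ 2 * p z.
Proof.
move=> zD; have [phi0 /(_ 0 (lexx _))[_]] := flow w zD.
have -> : boundary_point k B 0 w = 1.
  by rewrite /boundary_point (bm_start BM) mulr0 /expi cos0 sin0.
rewrite phi0 !divr1 => /has_time_derivativeP H.
apply: (@cvgC_normc _ _ 0^'+) => e e0; have e2 : 0 < e / 2 by rewrite divr_gt0.
have [h h0 {}H] := H _ e2.
have h2 : 0 < h / 2 by rewrite divr_gt0.
apply: filterS (near_right0 h2) => t /andP[t0 th].
have := H t; rewrite add0r phi0 gtr0_norm// => /(_ (ltW t0)) {}H.
have {}H : normc (phi t z w - z - (1 - z) ^+ 2 * p z * t%:C) <= e / 2 * t.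
  by apply: H; lra.
have tC : t%:C != 0 :> R[i] by rewrite -[0]/(0%:C) (inj_eq (@complexI R)) gt_eqF.
rewrite -(ltr_pM2r t0) -[X in normc _ * X < _]gtr0_norm// -normcC -normcM.
have -> : ((z - 1) ^+ 2 * p z - (phi t z w - z) / t%:C) * t%:C =
    - (phi t z w - z - (1 - z) ^+ 2 * p z * t%:C).
  by rewrite mulrBl divfK//; ring.
by rewrite normcN (le_lt_trans H)// ltr_pM2r//; lra.
Qed.

Lemma Psi_generator (f : R[i] -> R[i]) z :
  analytic_on unit_disk f -> unit_disk z ->
  generator_at P (Psi k B phi) f z (A_op k p f z).
Proof.
move=> fan zD; have z1 : normc z < 1 by rewrite -unit_diskE.
have [r [T [M [zr r1 T0 M0 flowT]]]] :=
  loewner_flow_short_time FF BM ph ap flow zD.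
have [_ _ [Cl [dl [dl0 Cl0 fl]]]] := analytic_cderiv2 fan zD.
have fc w : unit_disk w -> {for w, continuous f}.
  by move=> /(analytic_cderiv2 fan)[+ _ _]; exact: cderiv_continuous.
have [K K0 fK] := continuous_disk_bounded fc r1.
pose c1 := derive1 f z; pose c2 := derive1n 2 f z / 2.
have fl' : forall h, normc h <= dl ->
  normc (f (z + h) - f z - c1 * h - c2 * h ^+ 2) <= Cl * normc h ^+ 3 := fl.
have [Cg Cg0 fg] := cubic_bound_on_disk dl0 Cl0 K0 (ltW zr) (ltW r1) fK fl'.
have [C C0 HC] := remainder_bound k (ltW z1) M0 Cg0 fg.
(* 1/4 is the range of the bound on the mean of (cosh B_t - 1)^2. *)
pose T' := Num.min T (1 / 4).
have T'0 : 0 < T' by rewrite lt_min T0 divr_gt0.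
have T'T t : 0 < t <= T' -> 0 <= t <= T /\ t <= 1 / 4.
  by rewrite le_min => /andP[/ltW -> /andP[-> ->]].
pose X t w := f (Psi k B phi t z w).
pose xi t w := phi t z w - z.
pose al : R[i] := - (0 +i* k) * z * c1.
pose be : R[i] := - (k ^+ 2)%:C * (z * c1 + 2 * z ^+ 2 * c2).
have PsiE t w : Psi k B phi t z w = (z + xi t w) * expi (- (k * B t w)).
  by rewrite /Psi /boundary_point /xi addrC subrK expiN.
have mxi t : 0 < t <= T' -> cmeasurable (xi t).
  move=> /T'T[tT _]; have [_ _ mphi] := flowT t tT.
  by apply: cmeasurableD => //; exact: cmeasurable_cst.
have xiM t w : 0 < t <= T' -> normc (xi t w) <= M * t.
  by move=> /T'T[tT _]; have [+ _ _] := flowT t tT; apply.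
have phir t w : 0 < t <= T' -> normc (z + xi t w) <= r.
  by move=> /T'T[tT _]; have [_ + _] := flowT t tT; rewrite /xi addrC subrK.
have iX t : 0 < t <= T' -> cintegrable P (X t).
  move=> tT; have Psir w : normc (Psi k B phi t z w) <= r.
    by rewrite PsiE normc_mul_expi phir.
  apply: (@cintegrable_of_bounded _ _ _ P (X t) K); last by move=> w; exact: fK.
  apply: cmeasurable_comp; last first.
    by move=> w; apply: fc; rewrite unit_diskE (le_lt_trans (Psir w)).
  rewrite (_ : Psi k B phi t z = fun w => (z + xi t w) * expi (- (k * B t w))).
    apply: cmeasurableM.
      by apply: cmeasurableD; [exact: cmeasurable_cst|exact: mxi].
    apply: cmeasurable_expi; apply: measurableT_comp => //.
    apply: measurable_funM => //; apply: (brownian_measurable FF BM).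
    by case: (T'T t tT) => /andP[].
  by apply/funext => w; exact: PsiE.
have ixi t : 0 < t <= T' -> cintegrable P (xi t).
  move=> tT; apply: (@cintegrable_of_bounded _ _ _ P (xi t) (M * t)); first exact: mxi.
  by move=> w; exact: xiM.
pose S t w : R[i] := (sinhR (B t w))%:C.
pose Y t w : R[i] := (coshm1 (B t w))%:C.
have iS t : 0 < t -> cintegrable P (S t).
  by move=> t0; apply: cintegrable_real; exact: (brownian_sinh_integrable FF BM t0).
have iY t : 0 < t -> cintegrable P (Y t).
  by move=> t0; apply: cintegrable_real; exact: (brownian_coshm1_integrable FF BM t0).
(* Minus the explicit part of the expansion; added to f(Psi_t) it leaves the remainder [rem],
   integrable because every piece is. *)
pose rest t w := - f z + (- c1 * xi t w + (- al * S t w + - be * Y t w)).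
pose rem t w := X t w + rest t w.
have irest t : 0 < t <= T' -> cintegrable P (rest t).
  move=> /[dup] tT /andP[t0 _].
  apply: cintegrableD; first exact: cintegrable_cst.
  apply: cintegrableD; first by apply: cintegrableZ; exact: ixi.
  by apply: cintegrableD; apply: cintegrableZ; [exact: iS|exact: iY].
have irem t : 0 < t <= T' -> cintegrable P (rem t).
  by move=> tT; apply: cintegrableD; [exact: iX|exact: irest].
(* An exact identity; the coefficient [al] disappears because sinh B_t has mean 0. *)
have EX t : 0 < t <= T' -> cexpectation P (X t) - f z =
    c1 * cexpectation P (xi t) + be * (expR (t / 2) - 1)%:C +
    cexpectation P (rem t).
  move=> /[dup] tT /andP[t0 _].
  have -> : cexpectation P (rem t) = cexpectation P (X t) + (- f z +
      (- c1 * cexpectation P (xi t) + (- al * 0 + - be * (expR (t / 2) - 1)%:C))).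
    have i1 := cintegrableZ (- c1) (ixi t tT).
    have i2 := cintegrableZ (- al) (iS t t0).
    have i3 := cintegrableZ (- be) (iY t t0).
    have i23 := cintegrableD i2 i3.
    have i123 := cintegrableD i1 i23.
    rewrite [LHS](cexpectationD (iX t tT) (irest t tT)); congr (_ + _).
    rewrite [LHS](cexpectationD (cintegrable_cst P (- f z)) i123).
    rewrite cexpectation_cst; congr (_ + _).
    rewrite (cexpectationD i1 i23) (cexpectationD i2 i3).
    rewrite !cexpectationZ; [|exact: iY|exact: iS|exact: ixi].
    rewrite /S /Y !cexpectation_real (brownian_sinh_mean FF BM t0).
    by rewrite (brownian_coshm1_mean FF BM t0).
  by ring.
have remE t : 0 < t <= T' ->
    normc (cexpectation P (rem t)) <= 12 * C * Num.sqrt t * t.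
  move=> /[dup] tT /andP[t0 _]; have [_ t4] := T'T t tT.
  pose s := Num.sqrt t; have s0 : 0 < s by rewrite sqrtr_gt0.
  have s2 : s ^+ 2 = t by rewrite sqr_sqrtr// ltW.
  have s4 : s ^+ 2 <= 1 / 4 by rewrite s2.
  have s1 : s <= 1.
    rewrite leNgt; apply/negP => s1; have := exprn_ege1 2 (ltW s1); lra.
  have [iW EW] := error_weight_mean_le s0 s4.
  rewrite s2 in iW EW.
  have bound w : normc (rem t w) <=
      C * (s ^+ 3 + s * coshm1 (B t w) + coshm1 (B t w) ^+ 2 / s).
    have xis : normc (xi t w) <= M * s ^+ 2 by rewrite s2 xiM.
    have := HC s (B t w) (xi t w) s0 s1 xis (phir t w tT).
    rewrite -PsiE; congr (_ <= _); congr normc.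
    by rewrite /rem /rest /X /S /Y /al /be; ring.
  have := normc_cexpectation_le (irem t tT) (integrableZ_fun C iW) bound.
  move=> /le_trans; apply.
  rewrite RintegralZl//.
  have -> : 12 * C * s * t = 2 * (C * (6 * s ^+ 3)) by rewrite -s2; ring.
  by rewrite ler_wpM2l// ler_wpM2l.
split; first by apply: filterS (near_right0 T'0) => t tT; exact: iX.
have tC t : 0 < t -> t%:C != 0 :> R[i].
  by move=> t0; rewrite -[0]/(0%:C) (inj_eq (@complexI R)) gt_eqF.
have L1 : cexpectation P (xi t) / t%:C @[t --> 0^'+] --> (z - 1) ^+ 2 * p z.
  apply/cvgC_parts; split.
    under eq_fun do rewrite Re_divC cexpectationE.
    apply: (@Rintegral_div_cvg _ _ _ P (fun t w => complex.Re (xi t w)) T' M) => //.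
    - by move=> t t0 tT; case: (mxi t); rewrite ?t0.
    - move=> t w t0 tT; apply: (le_trans (normRe_le _)); apply: xiM.
      by rewrite t0.
    - move=> w; have [+ _] := proj1 (cvgC_parts _ _) (loewner_initial_speed w zD).
      by under eq_fun do rewrite Re_divC.
  under eq_fun do rewrite Im_divC cexpectationE.
  apply: (@Rintegral_div_cvg _ _ _ P (fun t w => complex.Im (xi t w)) T' M) => //.
  - by move=> t t0 tT; case: (mxi t); rewrite ?t0.
  - move=> t w t0 tT; apply: (le_trans (normIm_le _)); apply: xiM.
    by rewrite t0.
  - move=> w; have [_ +] := proj1 (cvgC_parts _ _) (loewner_initial_speed w zD).
    by under eq_fun do rewrite Im_divC.
have L2 : (((expR (t / 2) - 1) / t)%:C : R[i]) @[t --> (0 : R)^'+] -->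
    ((1 / 2)%:C : R[i]).
  apply: (@cvgC_normc _ _ 0^'+) => e e0.
  (* For t <= 1/4 the quadratic bound on exp(t / 2) applies, and the quotient differs from 1/2 by at
     most t / 2 < e. *)
  have e4 : 0 < Num.min e (1 / 4) by rewrite lt_min e0 divr_gt0.
  apply: filterS (near_right0 e4) => t /andP[t0].
  rewrite le_min => /andP[te t4].
  rewrite -rmorphB normcC -normrN opprB.
  have h1 := expR_ge1Dx (t / 2).
  have := @expR_le_quadratic R (t / 2).
  rewrite [(t / 2) ^+ 2](_ : _ = t * t / 4); last by field.
  have -> : (expR (t / 2) - 1) / t - 1 / 2 = (expR (t / 2) - 1 - t / 2) / t.
    by field; rewrite gt_eqF.
  move=> h2; rewrite normrM normfV (gtr0_norm t0) ltr_pdivrMr//.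
  rewrite ger0_norm; last by lra.
  have : t * t <= e * t by rewrite ler_wpM2r// ltW.
  have : 0 < e * t by rewrite mulr_gt0.
  lra.
have L3 : cexpectation P (rem t) / t%:C @[t --> 0^'+] --> (0 : R[i]).
  apply: (@cvgC_normc _ _ 0^'+) => e e0.
  have C1 : 0 < 12 * C + 1 by lra.
  (* With sqrt t <= q / 2 the bound 12 C sqrt t falls below e; the 1 covers C = 0. *)
  pose q := e / (12 * C + 1).
  have q0 : 0 < q by rewrite divr_gt0.
  have q2 : 0 < Num.min T' ((q / 2) ^+ 2) by rewrite lt_min T'0 exprn_gt0// divr_gt0.
  apply: filterS (near_right0 q2) => t /andP[t0].
  rewrite le_min => /andP[tT tq].
  rewrite sub0r normcN normcM normcV normcC (gtr0_norm t0) ltr_pdivrMr//.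
  have tT' : 0 < t <= T' by rewrite t0.
  rewrite (le_lt_trans (remE t tT'))// ltr_pM2r//.
  have sq : Num.sqrt t <= q / 2.
    have qq : q / 2 = Num.sqrt ((q / 2) ^+ 2).
      by rewrite sqrtr_sqr ger0_norm// ltW// divr_gt0.
    by rewrite [leRHS]qq; exact: ler_wsqrtr.
  have -> : e = (12 * C + 1) * q by rewrite /q mulrC divfK// gt_eqF.
  have C12 : 0 <= 12 * C by rewrite mulr_ge0.
  have := ler_wpM2l C12 sq.
  have : 12 * C * (q / 2) <= 12 * C * q by rewrite ler_wpM2l//; lra.
  rewrite [(_ + 1) * q]mulrDl; lra.
have L : c1 * (cexpectation P (xi t) / t%:C) + be * ((expR (t / 2) - 1) / t)%:C +
    cexpectation P (rem t) / t%:C @[t --> 0^'+] --> A_op k p f z.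
  have -> : A_op k p f z = c1 * ((z - 1) ^+ 2 * p z) + be * (1 / 2)%:C + 0.
    have half : (1 / 2)%:C = 2^-1 :> R[i].
      by rewrite mul1r fmorphV rmorph_nat.
    have khalf : (k ^+ 2 / 2)%:C = (k ^+ 2)%:C / 2 :> R[i].
      by rewrite rmorphM fmorphV rmorph_nat.
    by rewrite /A_op /be /c2 /c1 khalf half; field.
  exact: (cvgD (cvgD (cvg_cstMl (c := c1) L1) (cvg_cstMl (c := be) L2)) L3).
apply: cvg_trans L; apply: near_eq_cvg.
apply: filterS (near_right0 T'0) => t tT; have t0 : 0 < t by case/andP: tT.
by rewrite (EX t tT) rmorphM fmorphV; ring.
Qed.

End generator.

Theorem mainTheorem11 (R : realType) (d : measure_display)
    (Omega : measurableType d) (P : probability Omega R)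
    (F : R -> set (set Omega)) (B : R -> Omega -> R) (k : R)
    (p : R[i] -> R[i]) (a : nat -> R[i]) (phi : R -> R[i] -> Omega -> R[i]) :
  filtration F ->
  brownian_motion P F B ->
  holomorphic_on unit_disk p ->
  (forall z, unit_disk z -> 0 <= complex.Re (p z)) ->
  (forall z, unit_disk z -> series (fun n => a n * z ^+ n) @ \oo --> p z) ->
  loewner_flow p (boundary_point k B) phi ->
  forall f : R[i] -> R[i], analytic_on unit_disk f ->
  forall z, unit_disk z ->
  [/\ generator_at P (Psi k B phi) f z (A_op k p f z),
      cvgn (L_series a f z) &
      A_op k p f z = - limn (L_series a f z)
                     - (k ^+ 2 / 2)%:C * L_op 0 (L_op 0 f) z].
Proof.
move=> FF BM ph _ ap flow f fan z zD.
have Lcvg := L_series_cvg (f := f) (ap z zD).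
have [_ d2f _] := analytic_cderiv2 fan zD.
split.
- exact: (Psi_generator FF BM ph ap flow fan zD).
- by apply/cvg_ex; eexists; exact: Lcvg.
- rewrite (cvg_lim _ Lcvg)// L_op0_sqr// /A_op; ring.
Qed.
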